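(* Let $n\ge 2$ and $1\le k\le n-1$ be integers. Suppose that $L$ is an origin-symmetric convex body in $\mathbb{R}^n$, and $\mu$ is a measure with even continuous non-negative density $g$ on $L$. Then $$\mu(L)\ \le\ n^{k/2}\,\frac{n}{n-k}\,c_{n,k}\,\max_{H\in Gr_{n-k}}\mu(L\cap H)\ |L|^{k/n},$$ where $c_{n,k}=|B_2^n|^{\frac{n-k}{n}}/|B_2^{n-k}|$.
   Context: A convex body is a compact convex set with non-empty interior; it is origin-symmetric if $L=-L$. $|\cdot|$ denotes volume (Lebesgue measure) of the appropriate dimension, and $B_2^m$ is the unit Euclidean ball in $\mathbb{R}^m$. $Gr_{n-k}$ is the Grassmannian of $(n-k)$-dimensional linear subspaces of $\mathbb{R}^n$. That $\mu$ has density $g$ means $\mu(B)=\int_B g(x)\,dx$ for every Borel set $B\subset L$; even means $g(-x)=g(x)$. For sections, $\mu(L\cap H)=\int_{L\cap H} g$, the integral being with respect to $(n-k)$-dimensional Lebesgue measure on $H$. *)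

(* Defs.v *)
From HB Require Import structures.
From mathcomp Require Import all_boot all_order all_algebra.
From mathcomp Require Import all_classical all_reals all_analysis.
From mathcomp Require Import measurable_realfun.

Set Implicit Arguments.
Unset Strict Implicit.
Unset Printing Implicit Defensive.

Import Order.TTheory GRing.Theory Num.Theory.
Import numFieldNormedType.Exports.

Local Open Scope classical_set_scope.
Local Open Scope ring_scope.

(* 'rV[R]_n carries its usual topology, and is given its Borel sigma-algebra. *)
Section borel_rV.
Variables (R : realType) (n : nat).

Let borel : set (set 'rV[R]_n) := <<s @open 'rV[R]_n >>.

Let borel0 : borel set0. Proof. exact: sigma_algebra0. Qed.

Let borelC A : borel A -> borel (~` A). Proof. exact: sigma_algebraC. Qed.

Let borel_bigcup (F : (set 'rV[R]_n)^nat) :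
  (forall i, borel (F i)) -> borel (\bigcup_i F i).
Proof. exact: sigma_algebra_bigcup. Qed.

HB.instance Definition _ := @isMeasurable.Build
  (sigma_display (@open 'rV[R]_n)) 'rV[R]_n borel borel0 borelC borel_bigcup.

End borel_rV.

Section measurable_rV.
Context (R : realType).

Lemma open_measurable_rV n (A : set 'rV[R]_n) : open A -> measurable A.
Proof. exact: sub_sigma_algebra. Qed.

Lemma continuous_measurable_rV m n (f : 'rV[R]_m -> 'rV[R]_n) :
  continuous f -> measurable_fun setT f.
Proof.
move=> cf; apply: (measurability _ (erefl : measurable = <<s @open 'rV[R]_n >>)).
move=> _ [A oA <-]; rewrite setTI; apply: open_measurable_rV.
by move/continuousP : cf; apply.
Qed.

Lemma measurable_coord n (i : 'I_n) :
  measurable_fun setT (fun x : 'rV[R]_n => x ord0 i).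
Proof.
apply: (measurability _ (RGenOpens.measurableE R)).
move=> _ [_ [a [b ->] <-]]; rewrite setTI; apply: open_measurable_rV.
have /continuousP : continuous (fun x : 'rV[R]_n => x ord0 i).
  exact: coord_continuous.
by apply; exact: interval_open.
Qed.

Let box n (q : 'rV[rat]_n * rat) : set 'rV[R]_n :=
  [set y | forall i, `|ratr (q.1 ord0 i) - y ord0 i| < ratr q.2].

Let open_box n (A : set 'rV[R]_n) x : open A -> A x ->
  exists q, box q x /\ box q `<=` A.
Proof.
rewrite openE => /(_ x)/[apply]; rewrite /interior => /nbhs_ballP[e /= e0 eA].
have /rat_in_itvoo[r] : 0 < e / 2 by rewrite divr_gt0.
rewrite in_itv/= => /andP[r0 re].
have /(_ _)/cid-/all_sig[q qP] i :
    exists q : rat, `|ratr q - x ord0 i| < ratr r :> R.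
  have /rat_in_itvoo[q] : x ord0 i - ratr r < x ord0 i + ratr r :> R.
    by rewrite ltrD2l gtrN.
  by rewrite in_itv/= => qx; exists q; rewrite ltr_distl.
exists (\row_i q i, r); split=> [i|y yq]; first by rewrite /= mxE.
apply: eA; split=> // i j; rewrite ord1 /ball/=.
have := yq j; rewrite /= mxE => yqj.
rewrite (le_lt_trans (ler_distD (ratr (q j)) _ _))//.
by rewrite (splitr e) ltrD// (lt_trans _ re)// distrC// distrC.
Qed.

Lemma measurable_fun_rVP d (T : measurableType d) n (f : T -> 'rV[R]_n) :
  measurable_fun setT f <->
  forall i, measurable_fun setT (fun x => f x ord0 i).
Proof.
split=> [mf i|mf].
  exact: measurableT_comp (measurable_coord i) mf.
apply: (measurability _ (erefl : measurable = <<s @open 'rV[R]_n >>)).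
move=> _ [A oA <-]; rewrite setTI.
pose B (k : nat) : set 'rV[R]_n :=
  if unpickle k is Some q then [set y | box q y /\ box q `<=` A] else set0.
have -> : A = \bigcup_k B k.
  apply/seteqP; split=> [x Ax|x [k _]].
    have [q [qx qA]] := open_box oA Ax.
    by exists (pickle q) => //; rewrite /B pickleK.
  by rewrite /B; case: unpickle => // q [qx]; apply.
rewrite preimage_bigcup; apply: bigcupT_measurable => k; rewrite /B.
case: unpickle => [q|]; last by rewrite preimage_set0.
have [qA|nqA] := pselect (box q `<=` A); last first.
  by rewrite [X in measurable X](_ : _ = set0)// -subset0 => x [].
rewrite [X in measurable X](_ : _ = \bigcap_(i in [set: 'I_n])
    ((fun x => `|ratr (q.1 ord0 i) - f x ord0 i|) @^-1` `]-oo, ratr q.2[)).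
  apply: fin_bigcap_measurable => // i _.
  rewrite -[X in measurable X]setTI.
  have : measurable_fun setT (fun x => `|ratr (q.1 ord0 i) - f x ord0 i|).
    by apply: measurableT_comp => //; apply: measurable_funB.
  by apply=> //; exact: measurable_itv.
apply/seteqP; split=> [x [xq _] i _|x xq]; first by rewrite /= in_itv/=; exact: xq.
by split=> // i; have := xq i I; rewrite /= in_itv.
Qed.

End measurable_rV.

Section lebesgue_step.
Context (R : realType) (n : nat).

Definition cons_rV (p : measurableTypeR R * 'rV[R]_n) : 'rV[R]_n.+1 :=
  \row_i if unlift ord0 i is Some j then p.2 ord0 j else p.1.

Lemma measurable_cons_rV : measurable_fun setT cons_rV.
Proof.
apply/measurable_fun_rVP => i; rewrite /cons_rV.
case: (unliftP ord0 i) => [j ->|->].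
  under eq_fun do rewrite mxE liftK.
  exact: measurableT_comp (measurable_coord j) measurable_snd.
by under eq_fun do rewrite mxE unlift_none; exact: measurable_fst.
Qed.

Variable m : {sigma_finite_measure set 'rV[R]_n -> \bar R}.

(* The product of the Lebesgue measure of R with m, carried to 'rV[R]_n.+1. *)
Definition lebesgue_cons : set 'rV[R]_n.+1 -> \bar R :=
  pushforward (lebesgue_measure \x m)%E cons_rV.

Let lebesgue_cons0 : lebesgue_cons set0 = 0%E.
Proof. by rewrite /lebesgue_cons /pushforward preimage_set0 measure0. Qed.

Let lebesgue_cons_ge0 A : (0 <= lebesgue_cons A)%E.
Proof. by rewrite /lebesgue_cons /pushforward; exact: measure_ge0. Qed.

Let lebesgue_cons_sigma_additive : semi_sigma_additive lebesgue_cons.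
Proof.
move=> F mF tF mUF; rewrite /lebesgue_cons /pushforward preimage_bigcup.
apply: measure_semi_sigma_additive.
- by move=> k; rewrite -[X in measurable X]setTI; exact: measurable_cons_rV.
- apply/trivIsetP => /= i j _ _ ij; rewrite -preimage_setI.
  by move/trivIsetP : tF => /(_ _ _ _ _ ij) ->//; rewrite preimage_set0.
- rewrite -preimage_bigcup -[X in measurable X]setTI.
  exact: measurable_cons_rV.
Qed.

HB.instance Definition _ := isMeasure.Build _ _ _ lebesgue_cons
  lebesgue_cons0 lebesgue_cons_ge0 lebesgue_cons_sigma_additive.

Let uncons_rV (x : 'rV[R]_n.+1) :
    measurableTypeR R * 'rV[R]_n :=
  (x ord0 ord0, \row_j x ord0 (lift ord0 j)).

Let cons_rVK : cancel cons_rV uncons_rV.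
Proof.
case=> a v; rewrite /uncons_rV /cons_rV; congr pair.
  by rewrite mxE unlift_none.
by apply/rowP => j; rewrite !mxE liftK.
Qed.

Let measurable_uncons_rV : measurable_fun setT uncons_rV.
Proof.
apply: measurable_fun_pair; first exact: measurable_coord.
apply/measurable_fun_rVP => j; under eq_fun do rewrite mxE.
exact: measurable_coord.
Qed.

Let lebesgue_cons_sigma_finite : sigma_finite setT lebesgue_cons.
Proof.
have /sigma_finiteP[F [TF ndF Foo]] := sigma_finiteT (@lebesgue_measure R).
have /sigma_finiteP[G [TG ndG Goo]] := sigma_finiteT m.
exists (fun k => uncons_rV @^-1` (F k `*` G k)).
  rewrite -preimage_bigcup [X in _ @^-1` X](_ : _ = setT) ?preimage_setT//.
  apply/seteqP; split=> // -[x y] _.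
  have [[i _ Fx] [j _ Gy]] : (\bigcup_i F i) x /\ (\bigcup_i G i) y.
    by rewrite -TF -TG.
  exists (maxn i j) => //; split.
  - by move: x Fx; exact/subsetPset/ndF/leq_maxl.
  - by move: y Gy; exact/subsetPset/ndG/leq_maxr.
move=> k; have [mF Fk] := Foo k; have [mG Gk] := Goo k.
split.
  rewrite -[X in measurable X]setTI; apply: measurable_uncons_rV => //.
  exact: measurableX.
rewrite /lebesgue_cons /pushforward -comp_preimage.
rewrite (_ : uncons_rV \o cons_rV = id); last exact/funext/cons_rVK.
by rewrite product_measure1E// lte_mul_pinfty// ge0_fin_numE.
Qed.

HB.instance Definition _ := Measure_isSigmaFinite.Build _ _ _ lebesgue_cons
  lebesgue_cons_sigma_finite.

End lebesgue_step.

Fixpoint lebesgue_rV (R : realType) (n : nat) :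
    {sigma_finite_measure set 'rV[R]_n -> \bar R} :=
  if n is n'.+1 then lebesgue_cons (lebesgue_rV R n') else dirac (0 : 'rV[R]_0).

Section euclidean.
Context (R : realType) (n : nat).

(* The library norm `|x| of a row vector is the sup norm. *)
Definition euclidean_norm (x : 'rV[R]_n) : R :=
  Num.sqrt (\sum_(i < n) x ord0 i ^+ 2).

Definition euclidean_ball : set 'rV[R]_n := [set x | euclidean_norm x <= 1].

Definition convex_body (L : set 'rV[R]_n) : Prop :=
  [/\ compact L, convex_set (L : set (convex_lmodType 'rV[R]_n))
    & L° !=set0].

Definition origin_symmetric (L : set 'rV[R]_n) : Prop :=
  L = [set - x | x in L].

Definition Grassmannian (m : nat) : set {vspace 'rV[R]_n} :=
  [set H | \dim H = m].

(* The rows of U form an orthonormal basis of H, so that y |-> y *m U is a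
   linear isometry from 'rV[R]_(\dim H) onto H. *)
Definition orthonormal_basis (H : {vspace 'rV[R]_n}) :
    set 'M[R]_(\dim H, n) :=
  [set U | U *m U^T = 1%:M /\ forall i, row i U \in H].

Arguments orthonormal_basis : clear implicits.

Lemma orthonormal_basis_neq0 (H : {vspace 'rV[R]_n}) :
  orthonormal_basis H !=set0.
Proof.
rewrite /orthonormal_basis; move: {2}(\dim H) (erefl (\dim H)) => m.
move=> dimH; rewrite dimH; elim: m H dimH => [|m IH] H dimH.
  by exists 0; split=> [|[]//]; apply/matrixP => -[].
have v0 : vpick H != 0.
  by rewrite vpick0 -dimv_eq0 dimH.
set v := vpick H in v0; have vH : v \in H by exact: memv_pick.
pose s : R := \sum_(i < n) v ord0 i ^+ 2.
have s0 : 0 < s.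
  rewrite lt_neqAle sumr_ge0 ?andbT; last by move=> i _; exact: sqr_ge0.
  apply: contra v0; rewrite eq_sym psumr_eq0; last first.
    by move=> i _; exact: sqr_ge0.
  move=> /allP vi0; apply/eqP/rowP => i; rewrite mxE; apply/eqP.
  by have := vi0 i (mem_index_enum _); rewrite sqrf_eq0.
pose u : 'rV[R]_n := (Num.sqrt s)^-1 *: v.
have uu : u *m u^T = 1%:M.
  rewrite /u linearZ/= -scalemxAl -scalemxAr scalerA -invfM -expr2.
  rewrite sqr_sqrtr ?ltW//; apply/matrixP => i j; rewrite !ord1 !mxE eqxx.
  rewrite (eq_bigr (fun k => v ord0 k ^+ 2)) ?mulVf ?gt_eqF//.
  by move=> k _; rewrite mxE expr2.
have uH : u \in H by rewrite memvZ.
pose f := linfun (mulmxr u^T : 'rV[R]_n -> 'M[R]_1).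
have fE x : f x = x *m u^T by rewrite lfunE.
have dimfH : \dim (f @: H) = 1%N.
  apply/eqP; rewrite eqn_leq; apply/andP; split.
    by rewrite (leq_trans (dimvS (subvf _)))// dimvf.
  rewrite lt0n dimv_eq0; apply/eqP => fH0.
  have : f u \in (f @: H)%VS by exact: memv_img.
  rewrite fH0 memv0 fE uu => /eqP/matrixP/(_ ord0 ord0)/eqP.
  by rewrite !mxE eqxx oner_eq0.
have /IH[U [UU UH]] : \dim (H :&: lker f) = m.
  by have := limg_ker_dim f H; rewrite dimfH dimH addn1 => -[].
have {}UH i : row i U \in H /\ row i U *m u^T = 0.
  have := UH i; rewrite memv_cap memv_ker => /andP[-> /eqP].
  by rewrite fE.
have Uu : U *m u^T = 0.
  by apply/row_matrixP => i; rewrite row_mul (UH i).2 row0.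
have uU : u *m U^T = 0.
  by rewrite -[LHS]trmxK trmx_mul trmxK Uu trmx0.
have colU : col_mx u U *m (col_mx u U)^T = 1%:M.
  by rewrite tr_col_mx mul_col_row uu UU uU Uu -scalar_mx_block.
exists (col_mx u U); split=> [//|i].
case: (@split_ordP 1 m i) => j ->.
  have -> : row (lshift m j) (col_mx u U) = row j u by exact: rowKu.
  by rewrite ord1 (_ : row 0 u = u)//; apply/rowP => k; rewrite mxE.
have -> : row (rshift 1 j) (col_mx u U) = row j U by exact: rowKd.
exact: (UH j).1.
Qed.

Definition orthobasis (H : {vspace 'rV[R]_n}) : 'M[R]_(\dim H, n) :=
  xget 0 (orthonormal_basis H).

(* The (\dim H)-dimensional Lebesgue measure on H, as a measure on 'rV[R]_n
   concentrated on H. By rotation invariance of lebesgue_rV, it does not depend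
   on the orthonormal basis chosen. *)
Definition lebesgue_vspace (H : {vspace 'rV[R]_n}) :
    set 'rV[R]_n -> \bar R :=
  pushforward (lebesgue_rV R (\dim H)) (fun y => y *m orthobasis H).

Lemma measurable_mulmx m (U : 'M[R]_(m, n)) :
  measurable_fun setT (fun y : 'rV[R]_m => y *m U).
Proof.
apply/measurable_fun_rVP => j; under eq_fun do rewrite mxE.
apply: measurable_sum => i; apply: measurable_funM => //.
exact: measurable_coord.
Qed.

Let lebesgue_vspace0 H : lebesgue_vspace H set0 = 0%E.
Proof. by rewrite /lebesgue_vspace /pushforward preimage_set0 measure0. Qed.

Let lebesgue_vspace_ge0 H A : (0 <= lebesgue_vspace H A)%E.
Proof. by rewrite /lebesgue_vspace /pushforward; exact: measure_ge0. Qed.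

Let lebesgue_vspace_sigma_additive H :
  semi_sigma_additive (lebesgue_vspace H).
Proof.
move=> F mF tF mUF; rewrite /lebesgue_vspace /pushforward preimage_bigcup.
apply: measure_semi_sigma_additive.
- by move=> k; rewrite -[X in measurable X]setTI; exact: measurable_mulmx.
- apply/trivIsetP => /= i j _ _ ij; rewrite -preimage_setI.
  by move/trivIsetP : tF => /(_ _ _ _ _ ij) ->//; rewrite preimage_set0.
- rewrite -preimage_bigcup -[X in measurable X]setTI.
  exact: measurable_mulmx.
Qed.

HB.instance Definition _ H := isMeasure.Build _ _ _ (lebesgue_vspace H)
  (lebesgue_vspace0 H) (@lebesgue_vspace_ge0 H)
  (@lebesgue_vspace_sigma_additive H).

Definition has_density_on (mu : set 'rV[R]_n -> \bar R) (L : set 'rV[R]_n)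
    (g : 'rV[R]_n -> R) : Prop :=
  forall B, measurable B -> B `<=` L ->
    mu B = (\int[lebesgue_rV R n]_(x in B) (g x)%:E)%E.

(* mu (L `&` H), for a measure mu of density g on L: as a proper subspace
   is null for mu, this is by convention the integral of g with respect to
   the Lebesgue measure of H. *)
Definition section_measure (g : 'rV[R]_n -> R) (L : set 'rV[R]_n)
    (H : {vspace 'rV[R]_n}) : \bar R :=
  (\int[lebesgue_vspace H]_(x in L `&` [set` H]) (g x)%:E)%E.

End euclidean.

Arguments euclidean_ball : clear implicits.
Arguments Grassmannian : clear implicits.

Definition is_maximum (R : realType) (A : set (\bar R)) (M : \bar R) : Prop :=
  A M /\ ubound A M.

Definition slicing_constant (R : realType) (n k : nat) : R :=
  fine (lebesgue_rV R n (euclidean_ball R n)) `^ ((n - k)%:R / n%:R) /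
  fine (lebesgue_rV R (n - k) (euclidean_ball R (n - k))).

(* Main.v *)
(** By John's theorem there is an ellipsoid [E], the image of the Euclidean ball
    under a linear map [T], with [L] included in [E] and
    [|E| <= n^(n/2) |L|]; write [m = n - k] and [S = T^-1].

    Almost every [m x n] matrix [X] is [A Y] with [A] an [m x m] matrix and
    [Y = (1 | Z)], and then [dX = |det A|^k dA dZ].  Apply this to the
    integral of [h(x_1)] over the matrices [X] whose rows lie in [E], where [h]
    is the density extended by 0.  For fixed [Z] the integral over [A] is a weighted
    integral of [h] over the row space of [Y]; it is at most
    [b M D(YS)^(1-n) D(Y)^(-1)], where [M] is the largest section,
    [D(W) = sqrt (det (W W^T))], and [b] is a constant coming from the moments
    of determinants of points of the unit ball.  With [h = 1] the same formula
    says that the integral over [Z] of [D(YS)^(-n)] is a constant times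
    [|det S|^(-m)], which both determines [b] and, by Young's inequality, bounds
    the integral over [Z] of [D(YS)^(1-n) D(Y)^(-1)].  No invariant measure on the
    Grassmannian is needed.

    The maximum over [H] exists because a section integral is an upper
    semicontinuous function of an orthonormal frame spanning [H] (reverse Fatou),
    and the frames form a compact set. *)

Require Import Defs.
From mathcomp Require Import all_boot all_order all_algebra.
From mathcomp Require Import all_classical all_reals all_analysis.
From mathcomp Require Import measurable_realfun ring lra zify.

Set Implicit Arguments.
Unset Strict Implicit.
Unset Printing Implicit Defensive.

Import Order.TTheory GRing.Theory Num.Theory.
Import numFieldNormedType.Exports.

Local Open Scope classical_set_scope.
Local Open Scope ring_scope.

(** * Change of variables for Lebesgue measure *)

Section lebesgue_line.
Context {R : realType}.
Local Open Scope ereal_scope.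
Local Notation mu := (@lebesgue_measure R).

(** Two Euclidean structures compete. Sections are measured in the standard one, which produces
    [D(Y)], while the rows range over the ellipsoid, which produces [D(YS)]; this mismatch is what
    Young's inequality resolves. It separates the two factors into [D(YS)^(-n)] and [D(Y)^(-n)],
    whose integrals are the case [h = 1] at [S] and at the identity matrix, and its free weight is
    chosen to balance them. Only the first row carries [h], so that the other [m - 1] rows
    contribute an explicit constant factor. The constant [b] is eliminated through the moment of
    [|x|^k] over the unit ball of dimension [m], which is [m / n] times its volume: hence the factor
    [n / (n - k)]. The factor [n^(k/2)] is the power [k / n] of John's volume ratio [n^(n/2)]. The
    changes of variables are stated for non-negative functions with values in [[0, +oo]], so that
    Tonelli's theorem applies without integrability. Finiteness of the constants is read off
    afterwards, from products equal to a positive real. *)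

Lemma ge0_integral_shift (f : R -> \bar R) (a : R) :
  measurable_fun setT f -> (forall x, 0 <= f x) ->
  \int[mu]_x f (x + a)%R = \int[mu]_x f x.
Proof.
move=> mf f0; pose s (x : measurableTypeR R) : measurableTypeR R := (x + a)%R.
have ms : measurable_fun setT s by exact: measurable_funD.
transitivity (\int[pushforward mu s]_x f x).
  by rewrite ge0_integral_pushforward// preimage_setT.
apply: eq_measure_integral => //= A mA _.
apply/esym/lebesgue_measure_unique => //= _ [[b c]] _ <-.
rewrite /pushforward (_ : s @^-1` _ = `](b - a)%R, (c - a)%R]%classic).
  rewrite !lebesgue_measure_itv/= !lte_fin ltrD2r; case: ifPn => // bc.
  by rewrite -!EFinD; congr EFin; ring.
apply/seteqP; rewrite /s; split=> x /=; rewrite !in_itv/= ltrBlDr lerBrDr//.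
Qed.

Lemma ge0_integral_opp (f : R -> \bar R) :
  measurable_fun setT f -> (forall x, 0 <= f x) ->
  \int[mu]_x f (- x)%R = \int[mu]_x f x.
Proof.
move=> mf f0.
transitivity (\int[pushforward mu (-%R : R -> measurableTypeR R)]_x f x).
  by rewrite ge0_integral_pushforward// preimage_setT.
by apply: eq_measure_integral => //= A mA _; exact: lebesgue_measureN.
Qed.

Lemma ge0_integral_scale (f : R -> \bar R) (c : R) :
  measurable_fun setT f -> (forall x, 0 <= f x) -> c != 0%R ->
  \int[mu]_x f (c * x)%R = `|c|^-1%:E * \int[mu]_x f x.
Proof.
wlog c0 : f c / (0 < c)%R => [hw mf f0 cN0|mf f0 _].
  have [c0|c0|c0] := ltgtP c 0%R; last by rewrite c0 eqxx in cN0.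
    transitivity (\int[mu]_x f ((- c) * - x)%R).
      by apply: eq_integral => x _; rewrite mulrNN.
    rewrite (ge0_integral_opp (f := fun x => f (- c * x)%R))//; last first.
      by apply: measurableT_comp => //; exact: measurable_funM.
    by rewrite hw// ?normrN// ?oppr_gt0 ?oppr_eq0.
  exact: hw.
pose s (x : measurableTypeR R) : measurableTypeR R := (c * x)%R.
have ms : measurable_fun setT s by exact: measurable_funM.
have c0' : (0 <= c)%R by exact: ltW.
(* The image of Lebesgue measure under [x |-> c * x], multiplied by [c], gives every half-open
   interval its length, so by uniqueness it is Lebesgue measure. *)
have -> : \int[mu]_x f x = \int[mscale (NngNum c0') (pushforward mu s)]_x f x.
  move=> ms'; apply: eq_measure_integral => A mA _.
  apply: lebesgue_measure_unique => //= _ [[a b]] _ <-.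
  rewrite /mscale/= /pushforward.
  rewrite (_ : s @^-1` _ = `](c^-1 * a)%R, (c^-1 * b)%R]%classic); last first.
    apply/seteqP; rewrite /s; split=> x /=; rewrite !in_itv/=.
      by rewrite ltr_pdivrMl// ler_pdivlMl//.
    by rewrite ltr_pdivrMl// ler_pdivlMl//.
  rewrite !lebesgue_measure_itv/= !lte_fin ltr_pM2l ?invr_gt0//.
  case: ifPn => // ab; last by rewrite mule0.
  by rewrite -!EFinD -EFinM; congr EFin; rewrite -mulrBr mulrA mulfV ?gt_eqF// mul1r.
rewrite ge0_integral_mscale//= ge0_integral_pushforward// preimage_setT.
rewrite muleA -EFinM gtr0_norm// mulVf ?gt_eqF// mul1e.
by apply: eq_integral.
Qed.

End lebesgue_line.

Section lebesgue_rV_theory.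
Context {R : realType}.
Local Open Scope ereal_scope.
Local Notation mu := (@lebesgue_measure R).
Local Notation lam := (lebesgue_rV R).

Lemma ge0_integral_cons n (f : 'rV[R]_n.+1 -> \bar R) :
  measurable_fun setT f -> (forall x, 0 <= f x) ->
  \int[lam n.+1]_x f x = \int[mu]_a \int[lam n]_v f (cons_rV (a, v)).
Proof.
move=> mf f0.
have mc : measurable_fun setT (@cons_rV R n) by exact: measurable_cons_rV.
have := ge0_integral_pushforward mc (mu \x lam n) measurableT mf (in1W f0).
rewrite preimage_setT fubini_tonelli1; last 2 first.
- exact: measurableT_comp mf mc.
- by move=> x; exact: f0.
by move=> <-; apply: eq_measure_integral.
Qed.

Lemma integral_rV0 (f : 'rV[R]_0 -> \bar R) :
  measurable_fun setT f -> \int[lam 0]_x f x = f 0%R.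
Proof. by move=> mf; rewrite /= integral_dirac// diracT mul1e. Qed.

Section measurable_entries.
Context d (T : measurableType d).

(** Entrywise, so that blocks, products and determinants reduce to real functions; only row vectors
    carry a sigma-algebra here. *)
Definition mx_measurable m n (G : T -> 'M[R]_(m, n)) :=
  forall i j, measurable_fun setT (fun t => G t i j).

Lemma mx_measurable_fun n (G : T -> 'rV[R]_n) :
  mx_measurable G -> measurable_fun setT G.
Proof. by move=> mG; apply/measurable_fun_rVP => i; exact: mG. Qed.

Lemma measurable_fun_mx n (G : T -> 'rV[R]_n) :
  measurable_fun setT G -> mx_measurable G.
Proof. by move=> /measurable_fun_rVP mG i j; rewrite (ord1 i); exact: mG. Qed.

Lemma mx_measurable_cst m n (A : 'M[R]_(m, n)) : mx_measurable (fun=> A).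
Proof. by move=> i j; exact: measurable_cst. Qed.

Lemma mx_measurableD m n (G H : T -> 'M[R]_(m, n)) :
  mx_measurable G -> mx_measurable H -> mx_measurable (fun t => G t + H t)%R.
Proof.
by move=> mG mH i j; under eq_fun do rewrite mxE; exact: measurable_funD.
Qed.

Lemma mx_measurableZ m n (a : T -> R) (G : T -> 'M[R]_(m, n)) :
  measurable_fun setT a -> mx_measurable G ->
  mx_measurable (fun t => a t *: G t)%R.
Proof.
by move=> mG mH i j; under eq_fun do rewrite mxE; exact: measurable_funM.
Qed.

Lemma mx_measurableM m n p (G : T -> 'M[R]_(m, n)) (H : T -> 'M[R]_(n, p)) :
  mx_measurable G -> mx_measurable H -> mx_measurable (fun t => G t *m H t)%R.
Proof.
move=> mG mH i j; under eq_fun do rewrite mxE.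
by apply: measurable_sum => k; exact: measurable_funM.
Qed.

Lemma mx_measurable_tr m n (G : T -> 'M[R]_(m, n)) :
  mx_measurable G -> mx_measurable (fun t => (G t)^T)%R.
Proof. by move=> mG i j; under eq_fun do rewrite mxE; exact: mG. Qed.

Lemma mx_measurable_row m n (G : T -> 'M[R]_(m, n)) i :
  mx_measurable G -> mx_measurable (fun t => row i (G t)).
Proof. by move=> mG k j; under eq_fun do rewrite mxE; exact: mG. Qed.

Lemma mx_measurable_row_mx m n p (G : T -> 'M[R]_(m, n)) (H : T -> 'M[R]_(m, p)) :
  mx_measurable G -> mx_measurable H -> mx_measurable (fun t => row_mx (G t) (H t)).
Proof.
move=> mG mH i j; case: (split_ordP j) => k ->.
  by under eq_fun do rewrite row_mxEl; exact: mG.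
by under eq_fun do rewrite row_mxEr; exact: mH.
Qed.

Lemma mx_measurable_col_mx m n p (G : T -> 'M[R]_(m, n)) (H : T -> 'M[R]_(p, n)) :
  mx_measurable G -> mx_measurable H -> mx_measurable (fun t => col_mx (G t) (H t)).
Proof.
move=> mG mH i j; case: (split_ordP i) => k ->.
  by under eq_fun do rewrite col_mxEu; exact: mG.
by under eq_fun do rewrite col_mxEd; exact: mH.
Qed.

Lemma mx_measurable_lsubmx m n p (G : T -> 'M[R]_(m, n + p)) :
  mx_measurable G -> mx_measurable (fun t => lsubmx (G t)).
Proof. by move=> mG i j; under eq_fun do rewrite mxE; exact: mG. Qed.

Lemma mx_measurable_rsubmx m n p (G : T -> 'M[R]_(m, n + p)) :
  mx_measurable G -> mx_measurable (fun t => rsubmx (G t)).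
Proof. by move=> mG i j; under eq_fun do rewrite mxE; exact: mG. Qed.

Lemma mx_measurable_dsubmx m n p (G : T -> 'M[R]_(m + n, p)) :
  mx_measurable G -> mx_measurable (fun t => dsubmx (G t)).
Proof. by move=> mG i j; under eq_fun do rewrite mxE; exact: mG. Qed.

Lemma mx_measurable_cons n (a : T -> R) (G : T -> 'rV[R]_n) :
  measurable_fun setT a -> mx_measurable G ->
  mx_measurable (fun t => cons_rV (a t, G t)).
Proof.
move=> ma mG; apply: measurable_fun_mx.
apply: (measurableT_comp (@measurable_cons_rV R n)).
by apply: measurable_fun_pair => //; exact: mx_measurable_fun.
Qed.

Lemma measurable_det m (G : T -> 'M[R]_m) :
  mx_measurable G -> measurable_fun setT (fun t => \det (G t)).
Proof.
move=> mG; rewrite /determinant; apply: measurable_sum => s.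
apply: measurable_funM => //; apply: measurable_prod => i _; exact: mG.
Qed.

End measurable_entries.

Lemma mx_measurable_id n : mx_measurable (fun v : 'rV[R]_n => v).
Proof. by apply: measurable_fun_mx; exact: measurable_id. Qed.

Lemma mx_measurable_comp d d' (T : measurableType d) (T' : measurableType d')
    m n (G : T' -> 'M[R]_(m, n)) (h : T -> T') :
  measurable_fun setT h -> mx_measurable G -> mx_measurable (fun t => G (h t)).
Proof. by move=> mh mG i j; exact: (measurableT_comp (mG i j) mh). Qed.

Lemma mx_measurable_fst d (T' : measurableType d) n :
  mx_measurable (fun p : 'rV[R]_n * T' => p.1).
Proof. by apply: measurable_fun_mx; exact: measurable_fst. Qed.

Lemma mx_measurable_snd d (T' : measurableType d) n :
  mx_measurable (fun p : T' * 'rV[R]_n => p.2).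
Proof. by apply: measurable_fun_mx; exact: measurable_snd. Qed.

Lemma measurable_fun_rV_comp d (T : measurableType d) n (f : 'rV[R]_n -> \bar R)
    (G : T -> 'rV[R]_n) :
  measurable_fun setT f -> mx_measurable G -> measurable_fun setT (fun t => f (G t)).
Proof.
by move=> mf /mx_measurable_fun mG; exact: (measurableT_comp mf mG).
Qed.

(** The dimensions [(p + q).+1] and [p.+1 + q] are convertible, but their ordinals are split
    differently, hence the comparison of indices by value. *)
Lemma cons_rV_row_mx p q a (x : 'rV[R]_p) (y : 'rV[R]_q) :
  cons_rV (a, row_mx x y) = row_mx (cons_rV (a, x)) y :> 'rV[R]_(p.+1 + q).
Proof.
apply/rowP => i; rewrite /cons_rV !mxE.
case: (@unliftP (p + q).+1 ord0 i) => [j ->|->] /=.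
  rewrite !mxE; case: splitP => [k jk|k jk]; case: splitP => [k' jk'|k' jk'] //=.
  - rewrite mxE; case: (unliftP ord0 k') => [l kl|kl].
      congr (x _ _); apply: val_inj => /=; rewrite -jk.
      by move: jk'; rewrite kl /= !/bump /= !add1n => -[].
    by move: jk'; rewrite kl.
  - have {}jk' : (@nat_of_ord (p + q) j).+1 = (p.+1 + k')%N by [].
    by exfalso; have := ltn_ord k; rewrite -jk; lia.
  - have {}jk' : (@nat_of_ord (p + q) j).+1 = k' by [].
    by exfalso; have := ltn_ord k'; rewrite -jk' jk; lia.
  - have {}jk' : (@nat_of_ord (p + q) j).+1 = (p.+1 + k')%N by [].
    by congr (y _ _); apply: val_inj => /=; lia.
case: splitP => [k jk|k /= jk]; last by exfalso; lia.
rewrite mxE (_ : k = ord0) ?unlift_none//.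
by apply: val_inj; rewrite /= -jk.
Qed.

Lemma ge0_integral_row_mx p q (f : 'rV[R]_(p + q) -> \bar R) :
  measurable_fun setT f -> (forall x, 0 <= f x) ->
  \int[lam (p + q)]_x f x = \int[lam p]_x \int[lam q]_y f (row_mx x y).
Proof.
elim: p f => [f mf f0|p IH f mf f0].
  rewrite integral_rV0.
    apply: eq_integral => y _; congr f; apply/rowP => i.
    case: (split_ordP i) => [[]//|j ->]; rewrite row_mxEr; congr (y _ _).
    exact: val_inj.
  apply: (measurable_fun_fubini_tonelli_F (fun p => f (row_mx p.1 p.2))) => //.
  apply: measurable_fun_rV_comp => //; apply: mx_measurable_row_mx.
    exact: mx_measurable_fst.
  exact: mx_measurable_snd.
rewrite (ge0_integral_cons (n := p + q)) // ge0_integral_cons; last 2 first.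
- apply: (measurable_fun_fubini_tonelli_F (fun p => f (row_mx p.1 p.2))) => //.
  apply: measurable_fun_rV_comp => //; apply: mx_measurable_row_mx.
    exact: mx_measurable_fst.
  exact: mx_measurable_snd.
- by move=> x; exact: integral_ge0.
apply: eq_integral => a _; rewrite IH.
- by apply: eq_integral => x _; apply: eq_integral => y _; rewrite cons_rV_row_mx.
- apply: measurable_fun_rV_comp => //; apply: mx_measurable_cons => //.
  exact: mx_measurable_id.
- by move=> x; exact: f0.
Qed.

Lemma cons_rVD n a b (x y : 'rV[R]_n) :
  (cons_rV (a, x) + cons_rV (b, y) = cons_rV (a + b, x + y))%R.
Proof.
apply/rowP => i; rewrite /cons_rV !mxE; case: (unliftP ord0 i) => [j|] _ //=.
by rewrite mxE.
Qed.

Lemma cons_rVZ n c a (x : 'rV[R]_n) :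
  (c *: cons_rV (a, x) = cons_rV (c * a, c *: x))%R.
Proof.
apply/rowP => i; rewrite /cons_rV !mxE; case: (unliftP ord0 i) => [j|] _ //=.
by rewrite mxE.
Qed.

Lemma cons_rV_surj n (v : 'rV[R]_n.+1) :
  v = cons_rV (v ord0 ord0, \row_j v ord0 (lift ord0 j)).
Proof.
apply/rowP => i; rewrite /cons_rV !mxE; case: (unliftP ord0 i) => [j|] -> //=.
by rewrite mxE.
Qed.

Lemma ge0_integral_rVD n (f : 'rV[R]_n -> \bar R) v :
  measurable_fun setT f -> (forall x, 0 <= f x) ->
  \int[lam n]_x f (x + v)%R = \int[lam n]_x f x.
Proof.
elim: n f v => [f v mf f0|n IH f v mf f0].
  by apply: eq_integral => x _; congr f; apply/rowP => -[].
rewrite [v]cons_rV_surj; set a := v _ _; set w := \row__ _.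
rewrite !ge0_integral_cons; try by [exact: mf|move=> x; exact: f0]; last first.
  apply: measurable_fun_rV_comp => //; apply: mx_measurableD.
    exact: mx_measurable_id.
  exact: mx_measurable_cst.
pose g b := \int[lam n]_x f (cons_rV (b, x)).
rewrite -(ge0_integral_shift (f := g) a); last 2 first.
- apply: (measurable_fun_fubini_tonelli_F (fun p => f (cons_rV p))) => //.
  by apply: measurableT_comp => //; exact: measurable_cons_rV.
- by move=> b; exact: integral_ge0.
apply: eq_integral => b _; rewrite /g.
rewrite -(IH (fun x => f (cons_rV (b + a, x)))%R w)//.
  by apply: eq_integral => x _; rewrite cons_rVD.
apply: measurable_fun_rV_comp => //; apply: mx_measurable_cons => //.
exact: mx_measurable_id.
Qed.

Lemma ge0_integral_rVZ n (f : 'rV[R]_n -> \bar R) c :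
  measurable_fun setT f -> (forall x, 0 <= f x) -> c != 0%R ->
  \int[lam n]_x f (c *: x)%R = (`|c| ^- n)%:E * \int[lam n]_x f x.
Proof.
move=> + + c0; elim: n f => [f mf f0|n IH f mf f0].
  rewrite expr0 invr1 mul1e.
  by apply: eq_integral => x _; congr f; apply/rowP => -[].
rewrite !ge0_integral_cons; try by [exact: mf|move=> x; exact: f0]; last first.
  apply: measurable_fun_rV_comp => //; apply: mx_measurableZ => //.
  exact: mx_measurable_id.
pose g b := \int[lam n]_x f (cons_rV (b, x)).
have mg : measurable_fun setT g.
  apply: (measurable_fun_fubini_tonelli_F (fun p => f (cons_rV p))) => //.
  by apply: measurableT_comp => //; exact: measurable_cons_rV.
have g0 b : 0 <= g b by exact: integral_ge0.
transitivity (\int[mu]_b ((`|c| ^- n)%:E * g (c * b)%R)).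
  apply: eq_integral => b _; rewrite /g.
  rewrite -(IH (fun x => f (cons_rV (c * b, x)))%R)//.
    by apply: eq_integral => x _; rewrite cons_rVZ.
  apply: measurable_fun_rV_comp => //; apply: mx_measurable_cons => //.
  exact: mx_measurable_id.
rewrite ge0_integralZl_EFin;
  try by [exact: measurableT|move=> b _; exact: g0|rewrite invr_ge0 exprn_ge0].
- by rewrite ge0_integral_scale// muleA -EFinM -invfM exprSr.
- by apply: measurableT_comp => //; exact: measurable_funM.
Qed.

End lebesgue_rV_theory.

(** * Generation of the invertible matrices by shears and block-diagonal matrices *)

Section unitmx_induction.

(** Gaussian elimination without permutations. The generators are those whose action on an integral
    over matrices is a translation or a scaling of the first row, or a translation of the remaining
    ones. *)
Lemma unitmx_ind (F : fieldType) (P : forall n, 'M[F]_n -> Prop) :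
  (forall A : 'M[F]_0, P 0%N A) ->
  (forall n (A B : 'M[F]_n), A \in unitmx -> B \in unitmx ->
     P n A -> P n B -> P n (A *m B)) ->
  (forall n (b : 'rV[F]_n), P (1 + n)%N (block_mx 1%:M b 0 1%:M)) ->
  (forall n (c : 'cV[F]_n), P (1 + n)%N (block_mx 1%:M 0 c 1%:M)) ->
  (forall n a (D : 'M[F]_n), a != 0 -> D \in unitmx -> P n D ->
     P (1 + n)%N (block_mx a%:M 0 0 D)) ->
  forall n (A : 'M[F]_n), A \in unitmx -> P n A.
Proof.
move=> P0 PM Pu Pl Pd; elim=> [A _|n IH]; first exact: P0.
have uu (b : 'rV[F]_n) : block_mx 1%:M b 0 1%:M \in @unitmx F (1 + n).
  by rewrite unitmxE det_ublock !det1 mulr1 unitr1.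
have ul (c : 'cV[F]_n) : block_mx 1%:M 0 c 1%:M \in @unitmx F (1 + n).
  by rewrite unitmxE det_lblock !det1 mulr1 unitr1.
have pivot (A : 'M[F]_(1 + n)) : A \in unitmx -> A ord0 ord0 != 0 -> P (1 + n)%N A.
  move=> uA a0; set a := A ord0 ord0 in a0.
  have aE : ulsubmx A = a%:M.
    apply/matrixP => i j; rewrite !ord1 !mxE /= mulr1n /a.
    by congr (A _ _); apply: val_inj.
  (* The Schur complement of the pivot; it is invertible because [\det A] is [a * \det D]. *)
  pose D := drsubmx A - a^-1 *: (dlsubmx A *m ursubmx A).
  have AE : A = block_mx 1%:M 0 (a^-1 *: dlsubmx A) 1%:M *m
      (block_mx a%:M 0 0 D *m block_mx 1%:M (a^-1 *: ursubmx A) 0 1%:M).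
    rewrite -[LHS]submxK aE !mulmx_block !(mul0mx, mulmx0, mul1mx, mulmx1, addr0, add0r).
    rewrite mul_scalar_mx scalerA mulfV// scale1r.
    rewrite mul_mx_scalar scalerA mulfV// scale1r.
    by rewrite -scalemxAl /D addrC subrK.
  have uD : D \in unitmx.
    move: uA; rewrite AE !unitmx_mul => /and3P[_ + _].
    rewrite !unitmxE det_ublock det_scalar1 unitrM => /andP[_].
    by [].
  rewrite AE; apply: (PM) => //.
  - by rewrite unitmx_mul uu andbT unitmxE det_ublock det_scalar1 unitrM
      -unitmxE uD unitfE a0.
  - apply: PM => //; last exact: (Pd _ _ _ a0 uD (IH _ uD)).
    by rewrite unitmxE det_ublock det_scalar1 unitrM -unitmxE uD unitfE a0.
move=> A uA; have [A0|A0] := eqVneq (A ord0 ord0) 0; last exact: pivot.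
have [i ci] : exists i : 'I_n, A (rshift 1 i) ord0 != 0.
  apply/existsP; apply: contraT => /existsPn c0; move: uA.
  rewrite unitmxE (expand_det_col _ ord0) big1 ?unitr0// => i _.
  case: (@split_ordP 1 n i) => j ->.
    by rewrite ord1 (_ : lshift n 0 = ord0) ?A0 ?mul0r//; exact: val_inj.
  by have := c0 j; rewrite negbK => /eqP ->; rewrite mul0r.
(* A zero corner is repaired by adding to the first row a row whose first entry is nonzero; the
   opposite shear undoes this. *)
pose b : 'rV[F]_n := delta_mx ord0 i.
have -> : A = block_mx 1%:M (- b) 0 1%:M *m (block_mx 1%:M b 0 1%:M *m A).
  rewrite mulmxA mulmx_block !(mul0mx, mulmx0, mul1mx, mulmx1, addr0, add0r).
  by rewrite subrr -scalar_mx_block mul1mx.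
apply: PM => //; first by rewrite unitmx_mul uu.
apply: pivot; first by rewrite unitmx_mul uu.
have l0 : lshift n ord0 = ord0 :> 'I_(1 + n) by exact: val_inj.
rewrite mxE big_split_ord/= big_ord1 l0 A0 mulr0 add0r.
have bE k : block_mx 1%:M b 0 1%:M ord0 (rshift 1 k) = b ord0 k.
  by rewrite -l0 block_mxEur.
rewrite (bigD1 i)//= big1 ?addr0 => [|k ki]; last first.
  by rewrite bE mxE (negbTE ki) andbF mul0r.
by rewrite bE mxE !eqxx mul1r.
Qed.

End unitmx_induction.

(** * Integration over matrices *)

Section matrix_integral.
Context {R : realType}.
Local Open Scope ereal_scope.
Local Notation mu := (@lebesgue_measure R).
Local Notation lam := (lebesgue_rV R).

(* Matrices carry no sigma-algebra: a function on 'M_(m, n) is measured and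
   integrated through this identification of 'M_(m, n) with 'rV_(m * n). *)
Fixpoint mx_of_rV m n : 'rV[R]_(m * n) -> 'M[R]_(m, n) :=
  match m with m'.+1 => fun v : 'rV[R]_(n + m' * n) =>
    col_mx (lsubmx v) (mx_of_rV (rsubmx v))
  | 0%N => fun=> 0%R end.

Fixpoint rV_of_mx m n : 'M[R]_(m, n) -> 'rV[R]_(m * n) :=
  match m with m'.+1 => fun X : 'M[R]_(1 + m', n) =>
    row_mx (usubmx X) (rV_of_mx (dsubmx X))
  | 0%N => fun=> 0%R end.

Lemma rV_of_mxK m n : cancel (@rV_of_mx m n) (@mx_of_rV m n).
Proof.
elim: m => [|m IH] X /=; first by apply/matrixP => -[].
by rewrite row_mxKl row_mxKr IH (@vsubmxK _ 1 m).
Qed.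

Lemma mx_of_rVD m n : {morph @mx_of_rV m n : u v / (u + v)%R}.
Proof.
elim: m => [|m IH] u v /=; first by rewrite addr0.
by rewrite !linearD/= IH (@add_col_mx _ 1 m).
Qed.

Definition matrix_measurable m n (F : 'M[R]_(m, n) -> \bar R) :=
  measurable_fun setT (F \o @mx_of_rV m n).

Lemma mx_measurable_mx_of_rV d (T : measurableType d) m n (h : T -> 'rV[R]_(m * n)) :
  measurable_fun setT h -> mx_measurable (fun t => mx_of_rV (h t)).
Proof.
move=> mh; suff : mx_measurable (@mx_of_rV m n) by apply: mx_measurable_comp.
elim: m {mh h} => [|m IH] /=; first exact: mx_measurable_cst.
apply: (mx_measurable_col_mx (m := 1)).
  exact: (mx_measurable_lsubmx (@mx_measurable_id R (n + m * n))).
apply: mx_measurable_comp IH; apply: mx_measurable_fun.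
exact: (mx_measurable_rsubmx (@mx_measurable_id R (n + m * n))).
Qed.

Lemma measurable_rV_of_mx d (T : measurableType d) m n (G : T -> 'M[R]_(m, n)) :
  mx_measurable G -> measurable_fun setT (fun t => rV_of_mx (G t)).
Proof.
elim: m G => [|m IH] G mG /=; first exact: measurable_cst.
apply: mx_measurable_fun; apply: mx_measurable_row_mx.
  by move=> i j; under eq_fun do rewrite mxE; exact: mG.
by apply: measurable_fun_mx; apply: IH; apply: (mx_measurable_dsubmx (m := 1)).
Qed.

Lemma matrix_measurable_comp d (T : measurableType d) m n
    (F : 'M[R]_(m, n) -> \bar R) (G : T -> 'M[R]_(m, n)) :
  matrix_measurable F -> mx_measurable G -> measurable_fun setT (fun t => F (G t)).
Proof.
move=> mF /measurable_rV_of_mx mG.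
rewrite (_ : (fun _ => _) = (F \o @mx_of_rV m n) \o (fun t => rV_of_mx (G t))).
  exact: measurableT_comp.
by apply/funext => t /=; rewrite rV_of_mxK.
Qed.

Definition mx_integral m n (F : 'M[R]_(m, n) -> \bar R) :=
  \int[lam (m * n)]_v F (mx_of_rV v).

Lemma mx_integral_ge0 m n (F : 'M[R]_(m, n) -> \bar R) :
  (forall X, 0 <= F X) -> 0 <= mx_integral F.
Proof. by move=> F0; exact: integral_ge0. Qed.

Lemma eq_mx_integral m n (F G : 'M[R]_(m, n) -> \bar R) :
  F =1 G -> mx_integral F = mx_integral G.
Proof. by move=> FG; apply: eq_integral => v _; exact: FG. Qed.

Lemma le_mx_integral m n (F G : 'M[R]_(m, n) -> \bar R) :
  matrix_measurable F -> matrix_measurable G ->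
  (forall X, 0 <= F X) -> (forall X, F X <= G X) ->
  mx_integral F <= mx_integral G.
Proof.
move=> mF mG F0 FG; apply: ge0_le_integral => //.
Qed.

Lemma mx_integralZl m n (F : 'M[R]_(m, n) -> \bar R) (c : R) :
  matrix_measurable F -> (forall X, 0 <= F X) -> (0 <= c)%R ->
  mx_integral (fun X => c%:E * F X) = c%:E * mx_integral F.
Proof. by move=> mF F0 c0; rewrite /mx_integral ge0_integralZl_EFin. Qed.

Lemma mx_integralZr m n (F : 'M[R]_(m, n) -> \bar R) (c : \bar R) :
  matrix_measurable F -> (forall X, 0 <= F X) -> 0 <= c ->
  mx_integral (fun X => F X * c) = mx_integral F * c.
Proof. by move=> mF F0 c0; rewrite /mx_integral ge0_integralZr. Qed.

Lemma measurable_mx_integral d (T : measurableType d) m n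
    (F : T -> 'M[R]_(m, n) -> \bar R) :
  measurable_fun setT (fun p : T * 'rV[R]_(m * n) => F p.1 (mx_of_rV p.2)) ->
  (forall t X, 0 <= F t X) ->
  measurable_fun setT (fun t => mx_integral (F t)).
Proof.
move=> mF F0.
by apply: (measurable_fun_fubini_tonelli_F (fun p => F p.1 (mx_of_rV p.2))).
Qed.

Lemma mx_integral_swap m n p q (F : 'M[R]_(m, n) -> 'M[R]_(p, q) -> \bar R) :
  measurable_fun setT
    (fun w : 'rV[R]_(m * n) * 'rV[R]_(p * q) => F (mx_of_rV w.1) (mx_of_rV w.2)) ->
  (forall X Y, 0 <= F X Y) ->
  mx_integral (fun X => mx_integral (F X)) =
  mx_integral (fun Y => mx_integral (F ^~ Y)).
Proof.
move=> mF F0.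
by apply: (fubini_tonelli (fun p => F (mx_of_rV p.1) (mx_of_rV p.2))).
Qed.

Lemma integral_mx_swap d (T : measurableType d)
    (nu : {sigma_finite_measure set T -> \bar R}) m n
    (F : T -> 'M[R]_(m, n) -> \bar R) :
  measurable_fun setT (fun p : T * 'rV[R]_(m * n) => F p.1 (mx_of_rV p.2)) ->
  (forall t X, 0 <= F t X) ->
  \int[nu]_t mx_integral (F t) = mx_integral (fun X => \int[nu]_t F t X).
Proof.
move=> mF F0.
by apply: (fubini_tonelli (fun p => F p.1 (mx_of_rV p.2))).
Qed.

Lemma mx_integral0 n (F : 'M[R]_(0, n) -> \bar R) :
  matrix_measurable F -> mx_integral F = F 0%R.
Proof. by move=> mF; exact: integral_rV0. Qed.

Lemma mx_integralS m n (F : 'M[R]_(1 + m, n) -> \bar R) :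
  matrix_measurable F -> (forall X, 0 <= F X) ->
  mx_integral F = \int[lam n]_x mx_integral (fun X => F (col_mx x X)).
Proof.
move=> mF F0; rewrite /mx_integral.
apply: etrans (ge0_integral_row_mx (p := n) (q := m * n) mF (fun v => F0 _)) _.
apply: eq_integral => x _; apply: eq_integral => v _.
by rewrite /= row_mxKl row_mxKr.
Qed.

End matrix_integral.

Ltac mx_measurability :=
  repeat match goal with
  | |- mx_measurable (fun=> ?A) => exact: mx_measurable_cst
  | |- mx_measurable (fun t => @col_mx _ ?a ?b ?c _ _) =>
      apply: (@mx_measurable_col_mx _ _ _ a c b)
  | |- mx_measurable (fun t => row_mx _ _) => apply: mx_measurable_row_mx
  | |- mx_measurable (fun t => _ *m _)%R => apply: mx_measurableM
  | |- mx_measurable (fun t => _ + _)%R => apply: mx_measurableD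
  | |- mx_measurable (fun t => _ *: _)%R => apply: mx_measurableZ
  | |- mx_measurable (fun t => trmx _) => apply: mx_measurable_tr
  | |- mx_measurable (fun t => row _ _) => apply: mx_measurable_row
  | |- mx_measurable (fun t => mx_of_rV _) => apply: mx_measurable_mx_of_rV
  | |- mx_measurable (@mx_of_rV _ _ _) =>
      apply: (mx_measurable_mx_of_rV (h := fun v => v))
  | |- mx_measurable _ => apply: measurable_fun_mx
  | |- measurable_fun _ (fun t => t) => exact: measurable_id
  | |- measurable_fun _ fst => exact: measurable_fst
  | |- measurable_fun _ snd => exact: measurable_snd
  | |- measurable_fun _ (fun t => fst t) => exact: measurable_fst
  | |- measurable_fun _ (fun t => snd t) => exact: measurable_snd
  | |- measurable_fun _ (fun t => fst (@?h t)) =>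
      apply: (measurableT_comp measurable_fst)
  | |- measurable_fun _ (fun t => snd (@?h t)) =>
      apply: (measurableT_comp measurable_snd)
  end.

Section left_mult.
Context {R : realType}.
Local Open Scope ereal_scope.
Local Notation lam := (lebesgue_rV R).

Lemma mx_integralD m n (F : 'M[R]_(m, n) -> \bar R) V :
  matrix_measurable F -> (forall X, 0 <= F X) ->
  mx_integral (fun X => F (X + V)%R) = mx_integral F.
Proof.
move=> mF F0; rewrite /mx_integral.
rewrite -[RHS](ge0_integral_rVD (rV_of_mx V))//.
by apply: eq_integral => v _; rewrite mx_of_rVD rV_of_mxK.
Qed.

(** The exponent [n] counts the columns, each being multiplied by [A]. An upper shear translates the
    first row, a lower shear translates the others, and the block-diagonal case scales the first
    row, with Jacobian [|a|^n], while the induction hypothesis treats the rest. *)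
Lemma mx_integral_mull m n (A : 'M[R]_m) (F : 'M[R]_(m, n) -> \bar R) :
  matrix_measurable F -> (forall X, 0 <= F X) -> A \in unitmx ->
  mx_integral (fun X => F (A *m X)) = (`|\det A| ^- n)%:E * mx_integral F.
Proof.
move=> + + uA; move: F.
pose P m (A : 'M[R]_m) := forall F : 'M[R]_(m, n) -> \bar R,
  matrix_measurable F -> (forall X, 0 <= F X) ->
  mx_integral (fun X => F (A *m X)) = (`|\det A| ^- n)%:E * mx_integral F.
rewrite -/(P m A); move: m A uA.
apply: unitmx_ind => [A|m A B uA uB PA PB|m b|m c|m a D a0 uD PD] F mF F0.
- rewrite det_mx00 normr1 expr1n invr1 mul1e.
  by apply: eq_mx_integral => X; congr F; apply/matrixP => -[].
- rewrite det_mulmx normrM exprMn invfM mulrC EFinM -muleA -PA// -PB//.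
    by apply: eq_mx_integral => X; rewrite mulmxA.
  by apply: (matrix_measurable_comp mF); mx_measurability.
- rewrite det_ublock !det1 mulr1 normr1 expr1n invr1 mul1e.
  have mF2 : measurable_fun setT
      (fun p : 'rV[R]_n * 'rV[R]_(m * n) => F (col_mx p.1 (mx_of_rV p.2))).
    by apply: (matrix_measurable_comp mF); mx_measurability.
  rewrite !mx_integralS; try by [exact: mF|move=> X; exact: F0]; last first.
    by apply: (matrix_measurable_comp mF); mx_measurability.
  (* The first row must be integrated innermost, since its translation [b *m X] depends on the other
     rows. *)
  rewrite !integral_mx_swap; try by [exact: mF2|move=> x X; exact: F0]; last first.
    by apply: (matrix_measurable_comp mF); mx_measurability.
  apply: eq_mx_integral => X.
  rewrite -[RHS](ge0_integral_rVD (b *m X))//; last first.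
    by apply: (matrix_measurable_comp mF); mx_measurability.
  apply: eq_integral => x _.
  by rewrite (@mul_block_col _ 1 m 1 m) !mul1mx mul0mx add0r.
- rewrite det_lblock !det1 mulr1 normr1 expr1n invr1 mul1e.
  rewrite !mx_integralS; try by [exact: mF|move=> X; exact: F0]; last first.
    by apply: (matrix_measurable_comp mF); mx_measurability.
  apply: eq_integral => x _.
  rewrite -[RHS](mx_integralD (c *m x))//; last first.
    by apply: (matrix_measurable_comp mF); mx_measurability.
  apply: eq_mx_integral => X.
  by rewrite (@mul_block_col _ 1 m 1 m) !mul1mx mul0mx addr0 addrC.
- rewrite det_ublock det_scalar1 normrM exprMn invfM EFinM -muleA.
  rewrite !mx_integralS; try by [exact: mF|move=> X; exact: F0]; last first.
    by apply: (matrix_measurable_comp mF); mx_measurability.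
  have mG : measurable_fun setT (fun x => mx_integral (fun X => F (col_mx x X))).
    apply: measurable_mx_integral => //.
    by apply: (matrix_measurable_comp mF); mx_measurability.
  have detD0 : (0 <= `|\det D| ^- n)%R by rewrite invr_ge0 exprn_ge0.
  rewrite -ge0_integralZl_EFin//; last by move=> x _; exact: mx_integral_ge0.
  rewrite -ge0_integral_rVZ//; last 2 first.
  - exact: measurable_funeM.
  - by move=> x; rewrite mule_ge0 ?lee_fin ?mx_integral_ge0.
  apply: eq_integral => x _; rewrite -PD//; last first.
    by apply: (matrix_measurable_comp mF); mx_measurability.
  apply: eq_mx_integral => X.
  by rewrite (@mul_block_col _ 1 m 1 m) !mul0mx add0r addr0 mul_scalar_mx.
Qed.

End left_mult.

Section right_mult.
Context {R : realType}.
Local Open Scope ereal_scope.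
Local Notation mu := (@lebesgue_measure R).
Local Notation lam := (lebesgue_rV R).

(** A row vector is read as a matrix with one column, so that left multiplication of matrices yields
    the change of variables [x |-> x *m A]. *)
Lemma integral_rV_tr n (f : 'rV[R]_n -> \bar R) :
  measurable_fun setT f -> (forall x, 0 <= f x) ->
  \int[lam n]_x f x = mx_integral (fun X : 'M[R]_(n, 1) => f X^T).
Proof.
elim: n f => [f mf f0|n IH f mf f0].
  rewrite integral_rV0// mx_integral0 ?trmx0//.
  by rewrite /matrix_measurable /comp; apply: measurable_fun_rV_comp => //; mx_measurability.
rewrite (mx_integralS (m := n)) //; last first.
  by rewrite /matrix_measurable /comp; apply: measurable_fun_rV_comp => //; mx_measurability.
have mF d (T : measurableType d) (h : T -> 'rV[R]_1) (k : T -> 'rV[R]_(n * 1)) :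
    measurable_fun setT h -> measurable_fun setT k ->
    measurable_fun setT (fun p => f (col_mx (h p) (mx_of_rV (k p)))^T).
  by move=> mh mk; rewrite /matrix_measurable /comp; apply: measurable_fun_rV_comp => //; mx_measurability.
rewrite ge0_integral_cons// [RHS]ge0_integral_cons; last 2 first.
- by apply: measurable_mx_integral => //; exact: mF.
- by move=> x; exact: mx_integral_ge0.
apply: eq_integral => a _; rewrite integral_rV0; last first.
  apply: measurable_mx_integral => //; apply: (mF) => //.
  apply: mx_measurable_fun; apply: mx_measurable_cons => //.
  by mx_measurability.
rewrite IH//; last first.
  rewrite /matrix_measurable /comp; apply: measurable_fun_rV_comp => //; apply: mx_measurable_cons => //.
  exact: mx_measurable_id.
apply: eq_mx_integral => X; congr f; apply/rowP => i; rewrite mxE.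
rewrite /cons_rV mxE; case: (unliftP ord0 i) => [j ->|->] /=.
  rewrite (_ : lift ord0 j = rshift 1 j); last exact: val_inj.
  by rewrite (@col_mxEd _ 1 n) mxE.
rewrite (_ : ord0 = lshift n ord0 :> 'I_(1 + n)); last exact: val_inj.
by rewrite (@col_mxEu _ 1 n) mxE (_ : 0%R = ord0 :> 'I_1) ?unlift_none//; exact: val_inj.
Qed.

Lemma ge0_integral_mulmx n (A : 'M[R]_n) (f : 'rV[R]_n -> \bar R) :
  measurable_fun setT f -> (forall x, 0 <= f x) -> A \in unitmx ->
  \int[lam n]_x f (x *m A) = (`|\det A|^-1)%:E * \int[lam n]_x f x.
Proof.
move=> mf f0 uA; rewrite !integral_rV_tr//; last first.
  by rewrite /matrix_measurable /comp; apply: measurable_fun_rV_comp => //; mx_measurability.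
rewrite -[in RHS]det_tr -[(_^-1)%R]expr1 exprVn -mx_integral_mull ?unitmx_tr//; last first.
  by rewrite /matrix_measurable /comp; apply: measurable_fun_rV_comp => //; mx_measurability.
by apply: eq_mx_integral => X; rewrite trmx_mul trmxK.
Qed.

Lemma mx_integral_mulr m n (B : 'M[R]_n) (F : 'M[R]_(m, n) -> \bar R) :
  matrix_measurable F -> (forall X, 0 <= F X) -> B \in unitmx ->
  mx_integral (fun X => F (X *m B)) = (`|\det B| ^- m)%:E * mx_integral F.
Proof.
move=> + + uB; elim: m F => [|m IH] F mF F0.
  rewrite expr0 invr1 mul1e.
  by apply: eq_mx_integral => X; congr F; apply/matrixP => -[].
rewrite !(mx_integralS (m := m))//; last first.
  by apply: (matrix_measurable_comp mF); mx_measurability.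
have dB : (0 <= `|\det B| ^- m)%R by rewrite invr_ge0 exprn_ge0.
rewrite exprS invfM EFinM -muleA -ge0_integralZl_EFin//; last 2 first.
- by move=> x _; exact: mx_integral_ge0.
- apply: measurable_mx_integral => //.
  by apply: (matrix_measurable_comp mF); mx_measurability.
rewrite -ge0_integral_mulmx//; last 2 first.
- apply: measurable_funeM; apply: measurable_mx_integral => //.
  by apply: (matrix_measurable_comp mF); mx_measurability.
- by move=> x; rewrite mule_ge0 ?lee_fin ?mx_integral_ge0.
apply: eq_integral => x _; rewrite -IH//; last first.
  by apply: (matrix_measurable_comp mF); mx_measurability.
by apply: eq_mx_integral => X; rewrite (@mul_col_mx _ 1 m).
Qed.

Lemma mx_integral_row_mx m p q (F : 'M[R]_(m, p + q) -> \bar R) :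
  matrix_measurable F -> (forall X, 0 <= F X) ->
  mx_integral F = mx_integral (fun A => mx_integral (fun W => F (row_mx A W))).
Proof.
elim: m F => [|m IH] F mF F0.
  rewrite !mx_integral0//.
  - by congr F; apply/matrixP => -[].
  - by apply: (matrix_measurable_comp mF); mx_measurability.
  - apply: measurable_mx_integral => //.
    by apply: (matrix_measurable_comp mF); mx_measurability.
rewrite !(mx_integralS (m := m))//; last 2 first.
- apply: measurable_mx_integral => //.
  by apply: (matrix_measurable_comp mF); mx_measurability.
- by move=> A; exact: mx_integral_ge0.
rewrite ge0_integral_row_mx//; last 2 first.
- apply: measurable_mx_integral => //.
  by apply: (matrix_measurable_comp mF); mx_measurability.
- by move=> x; exact: mx_integral_ge0.
apply: eq_integral => x _.
transitivity (\int[lam q]_y mx_integral (fun A => mx_integral (fun W =>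
    F (col_mx (row_mx x y) (row_mx A W))))).
  apply: eq_integral => y _; rewrite IH//.
  by apply: (matrix_measurable_comp mF); mx_measurability.
rewrite integral_mx_swap//; last 2 first.
- apply: measurable_mx_integral => //.
  by apply: (matrix_measurable_comp mF); mx_measurability.
- by move=> y A; exact: mx_integral_ge0.
apply: eq_mx_integral => A; rewrite (mx_integralS (m := m)); last 2 first.
- by apply: (matrix_measurable_comp mF); mx_measurability.
- by move=> W; exact: F0.
by apply: eq_integral => y _; apply: eq_mx_integral => W; rewrite -(@block_mxEv _ 1 m) block_mxEh.
Qed.

End right_mult.

(** * Singular matrices form a null set *)

Section singular_matrices.
Context {R : realType}.
Local Open Scope ereal_scope.
Local Notation mu := (@lebesgue_measure R).
Local Notation lam := (lebesgue_rV R).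

Lemma lebesgue_measure_setT : mu setT = +oo.
Proof. by rewrite -set_itvE lebesgue_measure_itv. Qed.

Lemma finite_set_root (p : {poly R}) : p != 0%R -> finite_set [set x | root p x].
Proof.
move=> p0; apply: contrapT => /(infinite_set_fset (size p))[B BA].
rewrite leqNgt => /negP; apply; apply: max_poly_roots => //; last exact: finmap.fset_uniq.
by apply/allP => x xB; exact: (BA x).
Qed.

(** The exceptional [t] are opposites of eigenvalues of [A], hence of roots of its characteristic
    polynomial, and are finite in number. *)
Lemma singular_shift m (A : 'M[R]_m) : mu [set t | \det (A + t%:M)%R = 0%R] = 0.
Proof.
apply: countable_lebesgue_measure0; apply: finite_set_countable.
apply: (@sub_finite_set _ _ (-%R @` [set x | root (char_poly A) x])); last first.
  by apply: finite_image; apply: finite_set_root; exact/monic_neq0/char_poly_monic.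
move=> t /= /eqP/det0P[v v0 vA]; exists (- t)%R; last by rewrite opprK.
rewrite -eigenvalue_root_char; apply/eigenvalueP; exists v => //.
by move/eqP: vA; rewrite mulmxDr mul_mx_scalar addr_eq0 -scaleNr => /eqP.
Qed.

(** Replace [A] by [A + t%:M] and integrate over [t] as well. By Tonelli and [singular_shift] the
    result is 0; by translation invariance it is the integral sought multiplied by the infinite
    length of the line. *)
Lemma mx_integral_singular m :
  mx_integral (fun A : 'M[R]_m => (\1_[set 0%R : R] (\det A))%:E) = 0.
Proof.
set I := fun A => _; have I0 A : 0 <= I A by rewrite lee_fin.
have mI d (T : measurableType d) (G : T -> 'M[R]_m) : mx_measurable G ->
    measurable_fun setT (fun t => I (G t)).
  move=> mG; apply/measurable_EFinP.
  have mi : measurable_fun setT (\1_[set 0%R : R] : R -> R).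
    by apply: measurable_indic; exact: measurable_set1.
  exact: (measurableT_comp mi (measurable_det mG)).
have mI0 : matrix_measurable I by apply: mI; mx_measurability.
have : \int[mu]_t mx_integral (fun A : 'M[R]_m => I (A + t%:M)%R) = 0.
  have mId d (T : measurableType d) (h : T -> measurableTypeR R) :
      measurable_fun setT h -> mx_measurable (fun t => (h t)%:M : 'M[R]_m).
    move=> mh i j; under eq_fun do rewrite mxE.
    by case: (i == j) => /=; [exact: mh|exact: measurable_cst].
  rewrite integral_mx_swap//; last first.
    by apply: mI; apply: mx_measurableD; [mx_measurability|apply: mId].
  transitivity (mx_integral (cst 0 : 'M[R]_m -> _)); last exact: integral0.
  apply: eq_mx_integral => A; rewrite -[RHS](singular_shift A).
  pose D := [set t | \det (A + t%:M)%R = 0%R].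
  have mD : measurable (D : set (measurableTypeR R)).
    have mA : mx_measurable (fun t : measurableTypeR R => A + t%:M)%R.
      apply: mx_measurableD; first exact: mx_measurable_cst.
      exact: (mId _ _ id).
    rewrite -[D]setTI.
    exact: (measurable_det mA measurableT (measurable_set1 0%R)).
  by rewrite -/D -[D]setIT -integral_indic.
under eq_integral do rewrite (mx_integralD _ mI0 I0).
rewrite (integral_cst mu measurableT (mx_integral I)).
move=> /eqP; rewrite mule_eq0 => /orP[/eqP//|/eqP muT0].
by have := etrans (esym lebesgue_measure_setT) muT0.
Qed.

Lemma eq_mx_integral_unit m (F G : 'M[R]_m -> \bar R) :
  matrix_measurable F -> matrix_measurable G ->
  (forall A, 0 <= F A) -> (forall A, 0 <= G A) ->
  {in unitmx, F =1 G} -> mx_integral F = mx_integral G.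
Proof.
move=> mF mG F0 G0 FG; apply: ge0_ae_eq_integral => //.
pose N := [set v : 'rV[R]_(m * m) | \det (mx_of_rV v) = 0%R].
have mN : measurable N.
  have mA : mx_measurable (@mx_of_rV R m m) by mx_measurability.
  rewrite -[N]setTI.
  exact: (measurable_det mA measurableT (measurable_set1 0%R)).
exists N; split => //.
  rewrite -[N]setIT -integral_indic// -[RHS](mx_integral_singular m).
  by apply: eq_integral => v _; congr EFin; rewrite !indicE; congr (_%:R).
move=> v /= FGv; apply: contrapT => /eqP dv; apply: FGv => _; apply: FG.
by rewrite unitmxE unitfE.
Qed.

End singular_matrices.

(** * Euclidean geometry *)

Section euclidean_theory.
Context {R : realType}.

Lemma euclidean_normE n (x : 'rV[R]_n) :
  euclidean_norm x = Num.sqrt ((x *m x^T) ord0 ord0).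
Proof.
by rewrite /euclidean_norm mxE; congr Num.sqrt; apply: eq_bigr => i _; rewrite mxE.
Qed.

Lemma sqr_euclidean_norm n (x : 'rV[R]_n) :
  (x *m x^T) ord0 ord0 = euclidean_norm x ^+ 2.
Proof.
rewrite euclidean_normE sqr_sqrtr// mxE sumr_ge0// => i _.
by rewrite mxE -expr2 sqr_ge0.
Qed.

Lemma euclidean_norm_ge0 n (x : 'rV[R]_n) : 0 <= euclidean_norm x.
Proof. exact: sqrtr_ge0. Qed.

Lemma euclidean_norm0 n : euclidean_norm (0 : 'rV[R]_n) = 0.
Proof. by rewrite euclidean_normE mul0mx mxE sqrtr0. Qed.

Lemma euclidean_norm_eq0 n (x : 'rV[R]_n) : (euclidean_norm x == 0) = (x == 0).
Proof.
apply/idP/idP => [|/eqP ->]; last by rewrite euclidean_norm0.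
move=> /eqP nx0; have := sqr_euclidean_norm x.
rewrite nx0 expr0n/= mxE => /eqP; rewrite psumr_eq0 => [/allP x0|i _]; last first.
  by rewrite mxE -expr2 sqr_ge0.
apply/eqP/rowP => i; rewrite mxE; apply/eqP.
by have := x0 i (mem_index_enum _); rewrite mxE -expr2 sqrf_eq0.
Qed.

Lemma euclidean_normZ n a (x : 'rV[R]_n) :
  euclidean_norm (a *: x) = `|a| * euclidean_norm x.
Proof.
rewrite !euclidean_normE linearZ/= -scalemxAl -scalemxAr scalerA mxE -expr2.
by rewrite sqrtrM ?sqr_ge0// sqrtr_sqr.
Qed.

Lemma euclidean_norm_mulmx m n (U : 'M[R]_(m, n)) (x : 'rV[R]_m) :
  U *m U^T = 1%:M -> euclidean_norm (x *m U) = euclidean_norm x.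
Proof.
by move=> UU; rewrite !euclidean_normE trmx_mul -mulmxA (mulmxA U) UU mul1mx.
Qed.

Lemma ler_coord_euclidean_norm n (x : 'rV[R]_n) i : `|x ord0 i| <= euclidean_norm x.
Proof.
rewrite -sqrtr_sqr ler_sqrt ?sumr_ge0// => [|j _]; last exact: sqr_ge0.
by rewrite (bigD1 i)//= lerDl sumr_ge0// => j _; exact: sqr_ge0.
Qed.

Lemma orthogonal_det n (Q : 'M[R]_n) : Q *m Q^T = 1%:M -> `|\det Q| = 1.
Proof.
move=> /(congr1 determinant); rewrite det_mulmx det_tr det1 -expr2 => /eqP.
by rewrite -real_normK ?num_real// sqrf_eq1 => /orP[/eqP//|/eqP h];
  have := normr_ge0 (\det Q); rewrite h ler0N1.
Qed.

Lemma orthogonal_unitmx n (Q : 'M[R]_n) : Q *m Q^T = 1%:M -> Q \in unitmx.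
Proof. by case/mulmx1_unit. Qed.

(* The Householder reflection exchanging e and u. *)
Lemma orthogonal_transitive n (e u : 'rV[R]_n) :
  euclidean_norm e = 1 -> euclidean_norm u = 1 ->
  exists Q : 'M[R]_n, [/\ Q *m Q^T = 1%:M, Q^T = Q & e *m Q = u].
Proof.
move=> e1 u1; have [->|ue] := eqVneq u e.
  by exists 1%:M; rewrite trmx1 !mulmx1.
pose v := u - e; pose s := (v *m v^T) ord0 ord0.
have sE : v *m v^T = s%:M by exact: mx11_scalar.
have s0 : s != 0 by rewrite /s sqr_euclidean_norm sqrf_eq0 euclidean_norm_eq0 subr_eq0.
pose p := (e *m u^T) ord0 ord0.
have pE : e *m u^T = p%:M by exact: mx11_scalar.
have pE' : u *m e^T = p%:M by rewrite -[LHS]trmxK trmx_mul trmxK pE tr_scalar_mx.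
have eE : e *m e^T = 1%:M.
  by rewrite [LHS]mx11_scalar sqr_euclidean_norm e1 expr1n.
have uE : u *m u^T = 1%:M.
  by rewrite [LHS]mx11_scalar sqr_euclidean_norm u1 expr1n.
have sp : s = 2 * (1 - p).
  rewrite /s /v linearB/= mulmxBl !mulmxBr uE eE pE pE'.
  by rewrite !mxE eqxx !mulr1n; ring.
have ev : e *m v^T = - (s / 2)%:M.
  rewrite /v linearB/= mulmxBr eE pE sp; apply/matrixP => i j.
  by rewrite !ord1 !mxE eqxx !mulr1n; field.
pose Q := 1%:M - (2 / s) *: (v^T *m v).
have QT : Q^T = Q by rewrite /Q linearB/= linearZ/= trmx1 trmx_mul trmxK.
exists Q; split => //.
- set P := v^T *m v in Q QT *.
  have PP : P *m P = s *: P.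
    by rewrite /P mulmxA -(mulmxA v^T) sE mul_mx_scalar -scalemxAl.
  rewrite QT /Q mulmxBl mul1mx -scalemxAl mulmxBr mulmx1 -scalemxAr PP.
  rewrite scalerBr !scalerA (_ : 2 / s * (2 / s) * s = 2 / s + 2 / s); last by field.
  by rewrite scalerDl opprB addrK subrK.
- rewrite mulmxBr mulmx1 -scalemxAr mulmxA ev mulNmx mul_scalar_mx scalerN scalerA.
  have -> : 2 / s * (s / 2) = 1 by field.
  by rewrite opprK scale1r addrC subrK.
Qed.

Lemma orthonormal_rows (m n : nat) (H : {vspace 'rV[R]_n}) : \dim H = m ->
  exists U : 'M[R]_(m, n), U *m U^T = 1%:M /\ forall i, row i U \in H.
Proof.
move=> <-; have [U [UU UH]] := orthonormal_basis_neq0 H.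
by exists U.
Qed.

Lemma row_space m n (W : 'M[R]_(m, n)) : row_free W ->
  exists2 H : {vspace 'rV[R]_n}, \dim H = m & forall x, x \in H = (x <= W)%MS.
Proof.
move=> fW; pose f := linfun (mulmxr W : 'rV[R]_m -> 'rV[R]_n).
have fE x : f x = x *m W by rewrite lfunE.
exists (limg f).
  rewrite limg_dim_eq ?dimvf ?dim_matrix; [exact: mul1n|apply/eqP].
  rewrite -subv0; apply/subvP => x; rewrite memv_cap memv_ker memv0 fE => /andP[_].
  by move=> /eqP xW; apply/eqP/(row_free_inj fW); rewrite mul0mx.
move=> x; apply/memv_imgP/submxP => [[y _ ->]|[y ->]]; exists y; rewrite ?fE//.
exact: memvf.
Qed.

(** No orthogonalisation is run: an orthonormal basis [U] of the row space of [W] is of the form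
    [A *m W], and [A *m (W *m U^T) = 1%:M] makes the square matrix [A] invertible. *)
Lemma Gram_Schmidt m n (W : 'M[R]_(m, n)) : row_free W ->
  exists B : 'M[R]_m, exists U : 'M[R]_(m, n),
    [/\ B \in unitmx, U *m U^T = 1%:M & W = B *m U].
Proof.
move=> /row_space[H /orthonormal_rows[U [UU UH]] HW].
have /submxP[A UA] : (U <= W)%MS by apply/row_subP => i; rewrite -HW.
have AW : A *m (W *m U^T) = 1%:M by rewrite mulmxA -UA.
have [uA uWU] := mulmx1_unit AW.
exists (invmx A), U; split => //; first by rewrite unitmx_inv.
by rewrite {1}UA mulKmx.
Qed.

End euclidean_theory.

(** * John's ellipsoid *)

Section john_scalars.
Context {R : realType}.

Lemma Bernoulli_ineq n (d : R) : 0 <= d <= 1 -> 1 - n%:R * d <= (1 - d) ^+ n.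
Proof.
move=> /andP[d0 d1]; elim: n => [|n IH]; first by rewrite mul0r subr0 expr0.
rewrite exprS; have d1' : 0 <= 1 - d by rewrite subr_ge0.
apply: le_trans (ler_wpM2l d1' IH).
by rewrite -natr1; have := mulr_ge0 (ler0n R n) (sqr_ge0 d); nra.
Qed.

(** Half-axes of a competing ellipsoid: [a] towards a point at distance [r], and [b] in the [N]
    orthogonal directions. The equation will keep it in the hull of the unit ball and the points at
    [r] and [- r], and [a * b ^+ N] is its volume relative to the ball. That it can exceed 1 once
    [r ^+ 2 > N.+1] is the origin of the [sqrt n] in John's theorem. *)
Lemma larger_ellipsoid_axes N (r : R) : (0 < N)%N -> 0 < r -> N.+1%:R < r ^+ 2 ->
  exists a b : R, [/\ 1 <= a < r, 0 < b,
    a ^+ 2 + b ^+ 2 * (r ^+ 2 - 1) = r ^+ 2 & 1 < a * b ^+ N].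
Proof.
move=> N0 r0; rewrite -natr1 -ltrBrDr; set A := r ^+ 2 - 1 => NA.
have n1 : 1 <= N%:R :> R by rewrite ler1n.
have n0 : 0 < N%:R :> R by apply: lt_le_trans n1.
have A0 : 0 < A by apply: lt_trans NA.
(* With [a ^+ 2 = 1 + d * A] and [b ^+ 2 = 1 - d], Bernoulli bounds the squared volume ratio below
   by [1 + d * (A - N - d * A * N)]; this [d] is half of the value at which the bound returns to
   1. *)
pose d := (A - N%:R) / (2 * A * N%:R).
have AN0 : 0 < 2 * A * N%:R by rewrite !mulr_gt0.
have d0 : 0 < d by rewrite divr_gt0// subr_gt0.
have dE : d * (A * N%:R) = (A - N%:R) / 2.
  by rewrite /d; field; rewrite !gt_eqF.
have d1 : d < 1.
  rewrite ltr_pdivrMr// mul1r; have : 0 <= A * (N%:R - 1).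
    by rewrite mulr_ge0 ?(ltW A0)// subr_ge0.
  by move: n1 A0; nra.
have a20 : 0 <= 1 + d * A by rewrite addr_ge0// mulr_ge0 ?ltW.
have b20 : 0 < 1 - d by rewrite subr_gt0.
exists (Num.sqrt (1 + d * A)), (Num.sqrt (1 - d)); split.
- apply/andP; split.
    by rewrite -[leLHS]sqrtr1 ler_sqrt// lerDl mulr_ge0 ?ltW.
  rewrite -[ltRHS](ger0_norm (ltW r0)) -sqrtr_sqr ltr_sqrt ?exprn_gt0//.
  by rewrite -ltrBrDl -/A gtr_pMl.
- by rewrite sqrtr_gt0.
- by rewrite !sqr_sqrtr ?(ltW b20)// -/A /A; ring.
- rewrite -(@ltr_pXn2r R 2)// ?nnegrE ?mulr_ge0 ?exprn_ge0 ?sqrtr_ge0//.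
  rewrite expr1n exprMn -exprM mulnC exprM !sqr_sqrtr ?(ltW b20)//.
  have dB : 0 <= d <= 1 by rewrite !ltW.
  apply: lt_le_trans (ler_wpM2l a20 (Bernoulli_ineq N dB)).
  have -> : (1 + d * A) * (1 - N%:R * d) = 1 + d * (A - N%:R - d * (A * N%:R)) by ring.
  rewrite dE ltrDl mulr_gt0//; lra.
Qed.

(* A point (c, w) of the unit ball with |w|^2 = W is sent to (a c, b w), which
   is a convex combination of a point of the ball and of (r, 0) or (- r, 0). *)
Lemma ellipsoid_in_hull (a b r c W : R) :
  1 <= a < r -> a ^+ 2 + b ^+ 2 * (r ^+ 2 - 1) = r ^+ 2 -> 0 <= W ->
  c ^+ 2 + W <= 1 ->
  exists2 s, `|s| < 1 & (a * c - s * r) ^+ 2 + b ^+ 2 * W <= (1 - `|s|) ^+ 2.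
Proof.
wlog c0 : c / 0 <= c => [hw|] /andP[a1 ar] abr W0 cW.
  have [c0|c0] := leP 0 c; first by apply: hw => //; rewrite a1.
  have c0' : 0 <= - c by rewrite oppr_ge0 ltW.
  have cW' : (- c) ^+ 2 + W <= 1 by rewrite sqrrN.
  have a1r : 1 <= a < r by rewrite a1.
  have [s s1 hs] := hw (- c) c0' a1r abr W0 cW'.
  exists (- s); first by rewrite normrN.
  by rewrite normrN (_ : (a * c - - s * r) ^+ 2 = (a * - c - s * r) ^+ 2)//; ring.
have r1 : 1 < r by exact: le_lt_trans ar.
set D := r ^+ 2 - 1 in abr *; have D0 : 0 < D by rewrite subr_gt0 exprn_egt1.
have bD : b ^+ 2 * D = r ^+ 2 - a ^+ 2 by rewrite -abr addrC addKr.
have W1 : W <= 1 - c ^+ 2 by lra.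
have bW : b ^+ 2 * W <= b ^+ 2 * (1 - c ^+ 2) by rewrite ler_wpM2l// sqr_ge0.
have c1 : c <= 1.
  by rewrite -(@ler_pXn2r R 2)// ?nnegrE// expr1n; lra.
have a0 : 0 < a by apply: lt_le_trans a1.
(* In this first case the image point already lies in the unit ball. *)
have [acr|acr] := leP (a * c * r) 1.
  exists 0; first by rewrite normr0.
  rewrite normr0 mul0r !subr0 expr1n; apply: le_trans (lerD (lexx _) bW) _.
  rewrite -(ler_pM2l D0) mulr1 -subr_ge0.
  have -> : D - D * ((a * c) ^+ 2 + b ^+ 2 * (1 - c ^+ 2)) =
      D - (a * c) ^+ 2 * D - (b ^+ 2 * D) * (1 - c ^+ 2) by ring.
  have -> : D - (a * c) ^+ 2 * D - (b ^+ 2 * D) * (1 - c ^+ 2) =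
      (a ^+ 2 - 1) * (1 - (c * r) ^+ 2) by rewrite bD /D; ring.
  have cr0 : 0 <= c * r by rewrite mulr_ge0// ltW// (lt_trans ltr01).
  have cr1 : c * r <= 1.
    by apply: le_trans acr; rewrite -mulrA ler_peMl.
  by rewrite mulr_ge0// subr_ge0 ?exprn_ege1// expr_le1.
have ac : a * c < r.
  by apply: le_lt_trans ar; rewrite ler_piMr// ltW.
(* The maximiser of the concave quadratic [(1 - s) ^+ 2 - (a * c - s * r) ^+ 2]; the slack
   multiplied by [D] is then the square of [r * c - a]. *)
pose s := (a * c * r - 1) / D.
have s0 : 0 < s by rewrite divr_gt0// subr_gt0.
have s1 : s < 1.
  by rewrite ltr_pdivrMr// mul1r ltrD2r expr2 ltr_pM2r// (lt_trans ltr01).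
have sD : s * D = a * c * r - 1 by rewrite /s divfK// gt_eqF.
exists s; rewrite gtr0_norm//; apply: le_trans (lerD (lexx _) bW) _.
rewrite -subr_ge0 -(pmulr_rge0 _ D0).
have -> : D * ((1 - s) ^+ 2 - ((a * c - s * r) ^+ 2 + b ^+ 2 * (1 - c ^+ 2))) =
    D - (s * D) ^+ 2 + 2 * (s * D) * (a * c * r - 1) - (a * c) ^+ 2 * D
    - (b ^+ 2 * D) * (1 - c ^+ 2) by rewrite /D; ring.
by rewrite sD bD (_ : _ - _ = (r * c - a) ^+ 2) ?sqr_ge0// /D; ring.
Qed.

End john_scalars.

(** * Limits and compactness for matrices *)

Section matrix_topology.
Context {R : realType}.

Lemma cvg_mx_entries T (F : set_system T) m n (f : T -> 'M[R]_(m, n))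
    (M : 'M[R]_(m, n)) : Filter F ->
  (forall i j, f x i j @[x --> F] --> M i j) -> f x @[x --> F] --> M.
Proof.
move=> FF fM; apply/cvg_ballP => e e0.
have : \near F, forall i j, ball (M i j) e (f F i j).
  apply: filter_forall => i; apply: filter_forall => j.
  by move/cvg_ballP : (fM i j); apply.
by apply: filterS => x h; split => // i j; exact: h.
Qed.

Lemma cvg_entry T (F : set_system T) m n (f : T -> 'M[R]_(m, n))
    (M : 'M[R]_(m, n)) i j : Filter F ->
  f x @[x --> F] --> M -> f x i j @[x --> F] --> M i j.
Proof. by move=> FF fM; exact: (cvg_comp _ _ fM (@coord_continuous R m n i j M)). Qed.

Lemma cvg_mulmx T (F : set_system T) m n p (f : T -> 'M[R]_(m, n))
    (g : T -> 'M[R]_(n, p)) (M : 'M[R]_(m, n)) (N : 'M[R]_(n, p)) : Filter F ->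
  f x @[x --> F] --> M -> g x @[x --> F] --> N -> f x *m g x @[x --> F] --> M *m N.
Proof.
move=> FF fM gN; apply: cvg_mx_entries => i j; rewrite mxE.
under eq_cvg do rewrite mxE.
apply: cvg_big => [|k _]; first exact: (@add_continuous R).
by apply: cvgM; exact: cvg_entry.
Qed.

Lemma cvg_trmx T (F : set_system T) m n (f : T -> 'M[R]_(m, n))
    (M : 'M[R]_(m, n)) : Filter F ->
  f x @[x --> F] --> M -> (f x)^T @[x --> F] --> M^T.
Proof.
move=> FF fM; apply: cvg_mx_entries => i j; rewrite mxE.
by under eq_cvg do rewrite mxE; exact: cvg_entry.
Qed.

Lemma continuous_determinant n : continuous (fun A : 'M[R]_n => \det A).
Proof.
have cprod (s : _) : continuous (fun A : 'M[R]_n => \prod_i A i (s i)).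
  apply: continuous_big => [|i _]; first exact: (@mul_continuous R).
  exact: coord_continuous.
rewrite /determinant; apply: continuous_big => [|s _]; first exact: (@add_continuous R).
by move=> A; apply: (@cvgM _ _ (nbhs A) _); [exact: cvg_cst|exact: cprod].
Qed.

Lemma mx_bounded_closed_compact m n (K : set 'M[R]_(m, n)) (c : R) :
  (forall M, K M -> forall i j, `|M i j| <= c) -> closed K -> compact K.
Proof.
move=> Kc cK; have cv : continuous (@vec_mx R m n).
  move=> v; apply: (@cvg_mx_entries _ (nbhs v)) => i j; rewrite mxE.
  by under eq_cvg do rewrite mxE; exact: (@coord_continuous R 1 (m * n) _ _ v).
have -> : K = @vec_mx R m n @` (@vec_mx R m n @^-1` K).
  by rewrite image_preimage// -subTset => M _; exists (mxvec M); rewrite ?mxvecK.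
apply: continuous_compact; first exact: continuous_subspaceT.
apply: bounded_closed_compact; last exact: closed_comp.
exists `|c|; split; first exact: num_real.
move=> d cd v Kv; rewrite /Num.Def.normr/= mx_normrE; apply/bigmax_leP.
split => [|[i j] _ /=]; first exact: le_trans (ltW cd).
rewrite ord1; case: (mxvec_indexP j) => k l.
apply: le_trans (ltW cd); apply: le_trans (ler_norm c).
by have := Kc _ Kv k l; rewrite mxE.
Qed.

End matrix_topology.

Section convex_bodies.
Context {R : realType} (n : nat) (L : set 'rV[R]_n).
Hypotheses (bodyL : convex_body L) (symL : origin_symmetric L).

Lemma convex_body_conv x y (t : R) : L x -> L y -> 0 <= t <= 1 ->
  L (t *: x + (1 - t) *: y).
Proof.
move=> Lx Ly /andP[t0 t1]; have [_ cL _] := bodyL.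
have := cL x y (Itv01 t0 t1) (mem_set Lx) (mem_set Ly).
by move/set_mem.
Qed.

Lemma symmetric_opp x : L x -> L (- x).
Proof. by move=> Lx; rewrite symL; exists x. Qed.

Lemma convex_body_bounded : exists c, forall x, L x -> forall i, `|x ord0 i| <= c.
Proof.
have [/compact_bounded[c [_ cL]] _ _] := bodyL.
exists (c + 1) => x Lx i; apply: le_trans (cL (c + 1) _ x Lx); last by rewrite ltrDl.
rewrite [leRHS]/Num.Def.normr/= mx_normrE.
by apply: (@le_bigmax _ R _ 0 (fun ij => `|x ij.1 ij.2|) (ord0, i)).
Qed.

Lemma convex_body_closed : closed L.
Proof. by apply: compact_closed; [exact: norm_hausdorff|case: bodyL]. Qed.

(** If a ball around [x0] lies in [L], then so does [- x0], and a small [x] is the midpoint of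
    [x0 + 2 *: x] and [- x0]. The radius [e / 4] keeps [2 *: x] strictly inside the ball of the sup
    norm. *)
Lemma convex_body_nbhs0 : exists2 e : R, 0 < e &
  forall x, euclidean_norm x <= e -> L x.
Proof.
have [_ _ [x0]] := bodyL; rewrite /interior => /nbhs_ballP[e /= e0 eL].
exists (e / 4); first by rewrite divr_gt0.
move=> x xe; have Lx0 : L (- x0) by apply/symmetric_opp/eL/ballxx.
have -> : x = 2^-1 *: (x0 + 2 *: x) + (1 - 2^-1) *: (- x0).
  rewrite scalerDr scalerA mulVf// scale1r (_ : 1 - 2^-1 = 2^-1); last by field.
  by rewrite scalerN addrAC subrr add0r.
apply: convex_body_conv => //; last by rewrite invr_ge0 invf_le1 ?ler0n ?ler1n.
apply: eL; split => // i j; rewrite ord1 /ball/= !mxE opprD addrA subrr add0r normrN.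
rewrite normrM ger0_norm//; have := ler_coord_euclidean_norm x j; lra.
Qed.

End convex_bodies.

Section John.
Context {R : realType} (N : nat) (L : set 'rV[R]_N.+1).
Hypotheses (N_gt0 : (0 < N)%N) (bodyL : convex_body L) (symL : origin_symmetric L).
Local Notation n := N.+1.

(** Only ellipsoids centred at the origin compete, which suffices for a symmetric body; one of
    maximal volume exists by compactness. *)
Let K : set 'M[R]_n := [set T | forall x, euclidean_norm x <= 1 -> L (x *m T)].

Let compact_K : compact K.
Proof.
have [c Lc] := convex_body_bounded bodyL.
apply: (@mx_bounded_closed_compact _ _ _ _ c).
  move=> T KT i j; have := Lc _ (KT (delta_mx ord0 i) _) j.
  rewrite -rowE mxE; apply; rewrite /euclidean_norm (bigD1 i)//= big1 => [|l li].
    by rewrite addr0 mxE !eqxx expr1n sqrtr1.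
  by rewrite mxE (negbTE li) andbF expr0n.
rewrite (_ : K = \bigcap_(x in [set x | euclidean_norm x <= 1])
    ((fun T : 'M[R]_n => x *m T) @^-1` L)).
  apply: closed_bigI => x _; apply: closed_comp; last exact: convex_body_closed.
  move=> T _; apply: (@cvg_mulmx _ _ (nbhs T)); first exact: cvg_cst.
  exact: cvg_id.
by apply/seteqP; split => T KT x; exact: KT.
Qed.

(** Up to the sign of [s], [z *m T] is a convex combination of [p] or [- p], with weight [|s|], and
    of a point of the ellipsoid of [T], both in [L]. *)
Let hull_T (T : 'M[R]_n) (p z : 'rV[R]_n) (s : R) : K T -> L p -> `|s| < 1 ->
  euclidean_norm (z - s *: (p *m invmx T)) <= 1 - `|s| -> T \in unitmx ->
  L (z *m T).
Proof.
move=> KT Lp s1 zs uT; set q := p *m invmx T in zs.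
have t0 : 0 < 1 - `|s| by rewrite subr_gt0.
pose y := (1 - `|s|)^-1 *: (z - s *: q).
have y1 : euclidean_norm y <= 1.
  by rewrite euclidean_normZ gtr0_norm ?invr_gt0// ler_pdivrMl// mulr1.
have [p' [Lp' sp]] : exists p', L p' /\ s *: p = `|s| *: p'.
  have [s0|s0] := leP 0 s; first by exists p; rewrite ger0_norm.
  exists (- p); split; first exact: symmetric_opp.
  by rewrite ltr0_norm// scalerN scaleNr opprK.
have -> : z *m T = `|s| *: p' + (1 - `|s|) *: (y *m T).
  rewrite -sp scalemxAl /y scalerA mulfV ?gt_eqF// scale1r mulmxBl -scalemxAl.
  by rewrite /q mulmxKV// addrC subrK.
by apply: convex_body_conv => //; [exact: KT|rewrite normr_ge0 ltW].
Qed.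

Lemma John_ellipsoid : exists T : 'M[R]_n, [/\ T \in unitmx,
  forall x, euclidean_norm x <= 1 -> L (x *m T) &
  forall x, L x -> euclidean_norm (x *m invmx T) <= Num.sqrt n%:R].
Proof.
have [e e0 eL] := convex_body_nbhs0 bodyL symL.
have Ke : K e%:M.
  move=> x x1; apply: eL; rewrite mul_mx_scalar euclidean_normZ gtr0_norm//.
  by rewrite ler_piMr// ltW.
have [|T KT Tmax] := compact_EVT_max (f := fun T : 'M[R]_n => `|\det T|)
    (ex_intro _ _ Ke) compact_K.
  apply: continuous_subspaceT => T.
  apply: (@cvg_comp _ _ _ _ _ (nbhs T)); first exact: continuous_determinant.
  exact: norm_continuous.
move/set_mem in KT.
have dT : 0 < `|\det T|.
  apply: lt_le_trans (Tmax _ (mem_set Ke)).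
  by rewrite det_scalar normr_gt0 expf_neq0// gt_eqF.
have uT : T \in unitmx by rewrite unitmxE unitfE -normr_gt0.
(* A point [p] of [L] beyond this bound would leave room for a linear image of the ball in [L] with
   larger determinant, against the maximality of [T]. *)
exists T; split => // p Lp; rewrite leNgt; apply/negP => pn.
set q := p *m invmx T in pn; set r := euclidean_norm q in pn.
have r0 : 0 < r by apply: le_lt_trans pn; exact: sqrtr_ge0.
have rn : n%:R < r ^+ 2.
  rewrite -[ltLHS](@sqr_sqrtr R n%:R)//.
  by rewrite ltr_pXn2r ?nnegrE ?sqrtr_ge0 ?ltW.
have [a [b [ar b0 abr ab1]]] := larger_ellipsoid_axes N_gt0 r0 rn.
pose e1 : 'rV[R]_n := delta_mx ord0 ord0.
have e11 : euclidean_norm e1 = 1.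
  rewrite /euclidean_norm (bigD1 ord0)//= big1 => [|l li].
    by rewrite addr0 mxE !eqxx expr1n sqrtr1.
  by rewrite mxE (negbTE li) andbF expr0n.
have u1 : euclidean_norm (r^-1 *: q) = 1.
  by rewrite euclidean_normZ gtr0_norm ?invr_gt0// mulVf// gt_eqF.
have [Q [QQ QT e1Q]] := orthogonal_transitive e11 u1.
pose d : 'rV[R]_n := \row_i if i == ord0 then a else b.
(* Since [Q] is an involution exchanging [e1] and the direction of [q], [E] stretches by [a] along
   [q] and scales by [b] orthogonally to it. *)
pose E := Q *m diag_mx d *m Q.
have dE : `|\det E| = a * b ^+ N.
  rewrite !det_mulmx !normrM (orthogonal_det QQ) mulr1 mul1r det_diag.
  rewrite big_ord_recl mxE eqxx (eq_bigr (fun=> b)) => [|i _]; last by rewrite mxE.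
  rewrite prodr_const card_ord ger0_norm// mulr_ge0 ?exprn_ge0 ?(ltW b0)//.
  by case/andP: ar => a1 _; apply: le_trans a1.
suff KE : K (E *m T).
  have := Tmax _ (mem_set KE); rewrite det_mulmx normrM dE leNgt => /negP; apply.
  by rewrite ltr_pMl.
move=> x x1; rewrite mulmxA; pose y := x *m Q; pose c := y ord0 ord0.
pose W := \sum_(i < N) y ord0 (lift ord0 i) ^+ 2.
have yE : euclidean_norm y ^+ 2 = c ^+ 2 + W.
  by rewrite /euclidean_norm sqr_sqrtr ?sumr_ge0 ?big_ord_recl// => i _; exact: sqr_ge0.
have cW : c ^+ 2 + W <= 1.
  by rewrite -yE euclidean_norm_mulmx// expr_le1// euclidean_norm_ge0.
have W0 : 0 <= W by rewrite sumr_ge0// => i _; exact: sqr_ge0.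
have [s s1 hs] := ellipsoid_in_hull ar abr W0 cW.
apply: (hull_T KT Lp s1 _ uT); rewrite -/q.
have -> : x *m E - s *: q = (y *m diag_mx d - (s * r) *: e1) *m Q.
  rewrite mulmxBl -scalemxAl e1Q scalerA -mulrA mulfV ?gt_eqF// mulr1.
  by rewrite /E /y !mulmxA.
rewrite euclidean_norm_mulmx//.
have s0 : 0 <= 1 - `|s| by rewrite subr_ge0 ltW.
rewrite -(@ler_pXn2r R 2)// ?nnegrE ?euclidean_norm_ge0//.
apply: le_trans hs; rewrite /euclidean_norm sqr_sqrtr; last first.
  by rewrite sumr_ge0// => i _; exact: sqr_ge0.
rewrite big_ord_recl mul_mx_diag {yE}; clearbody y.
rewrite !mxE !eqxx mulr1 [y _ _ * a]mulrC lerD2l.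
rewrite mulr_sumr ler_sum// => i _; rewrite !mxE /= mulr0 subr0.
by rewrite exprMn mulrC.
Qed.

End John.

(** * Integral geometry of sections *)

Section chart.
Context {R : realType}.
Local Open Scope ereal_scope.

(** Write [X = (A | W)]. For invertible [A], the substitution [W = A *m Z] acts on [k] columns and
    costs [|\det A| ^+ k]; the singular [A] are negligible. *)
Lemma mx_integral_chart m k (F : 'M[R]_(m, m + k) -> \bar R) :
  (0 < k)%N -> matrix_measurable F -> (forall X, 0 <= F X) ->
  mx_integral F = mx_integral (fun Z : 'M[R]_(m, k) =>
    mx_integral (fun A : 'M[R]_m =>
      (`|\det A| ^+ k)%:E * F (A *m row_mx 1%:M Z)%R)).
Proof.
move=> k0 mF F0.
have mdet d (T : measurableType d) (h : T -> 'rV[R]_(m * m)) :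
    measurable_fun setT h ->
    measurable_fun setT (fun t => (`|\det (mx_of_rV (h t))| ^+ k)%:E).
  move=> mh; apply/measurable_EFinP; apply: measurable_funX.
  apply: measurableT_comp => //; apply: measurable_det.
  by mx_measurability.
have mdF : measurable_fun setT (fun p : 'rV[R]_(m * m) * 'rV[R]_(m * k) =>
    (`|\det (mx_of_rV p.1)| ^+ k)%:E *
    F (mx_of_rV p.1 *m row_mx 1%:M (mx_of_rV p.2))%R).
  apply: emeasurable_funM; first by apply: mdet.
  by apply: (matrix_measurable_comp mF); mx_measurability.
have dF0 (A : 'M[R]_m) (Z : 'M[R]_(m, k)) :
    0 <= (`|\det A| ^+ k)%:E * F (A *m row_mx 1%:M Z)%R.
  by rewrite mule_ge0// lee_fin exprn_ge0.
rewrite mx_integral_row_mx//.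
transitivity (mx_integral (fun A => mx_integral (fun Z : 'M[R]_(m, k) =>
    (`|\det A| ^+ k)%:E * F (A *m row_mx 1%:M Z)%R))).
  apply: eq_mx_integral_unit.
  - apply: measurable_mx_integral => //.
    by apply: (matrix_measurable_comp mF); mx_measurability.
  - exact: measurable_mx_integral.
  - by move=> A; exact: mx_integral_ge0.
  - by move=> A; exact: mx_integral_ge0.
  move=> A uA; rewrite mx_integralZl ?exprn_ge0//; last first.
    by apply: (matrix_measurable_comp mF); mx_measurability.
  under [in RHS]eq_mx_integral do rewrite mul_mx_row mulmx1.
  rewrite (mx_integral_mull (F := fun W => F (row_mx A W)))//; last first.
    by apply: (matrix_measurable_comp mF); mx_measurability.
  rewrite muleA -EFinM mulfV ?mul1e// expf_eq0 k0 normr_eq0.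
  by move: uA; rewrite unitmxE unitfE.
exact: mx_integral_swap.
Qed.

End chart.

(** * Volume and moments of the Euclidean ball *)

Definition cube {R : realType} n (r : R) : set 'rV[R]_n :=
  [set x | forall i, `|x ord0 i| <= r].
Arguments cube {R} n r.

Section ball_volume.
Context {R : realType}.
Local Open Scope ereal_scope.
Local Notation lam := (lebesgue_rV R).
Local Notation B n := (euclidean_ball R n).

Lemma measurable_euclidean_norm d (T : measurableType d) n (G : T -> 'rV[R]_n) :
  mx_measurable G -> measurable_fun setT (fun t => euclidean_norm (G t)).
Proof.
move=> mG; rewrite /euclidean_norm; apply: (measurableT_comp (f := @Num.sqrt R)).
  by apply: continuous_measurable_fun; exact: sqrt_continuous.
by apply: measurable_sum => i; apply: measurable_funX; exact: mG.
Qed.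

Lemma measurable_euclidean_ball n : measurable (B n).
Proof.
have mn : measurable_fun setT (@euclidean_norm R n).
  by apply: (measurable_euclidean_norm (G := id)); exact: mx_measurable_id.
rewrite -[B n]setTI (_ : B n = @euclidean_norm R n @^-1` `]-oo, 1%R]).
  by apply: mn => //; exact: measurable_itv.
by apply/seteqP; split => x; rewrite /= in_itv.
Qed.

Lemma indic_ball n (x : 'rV[R]_n) :
  \1_(B n) x = (if (euclidean_norm x <= 1)%R then 1 else 0)%R :> R.
Proof.
rewrite indicE; case: ifPn => h; first by rewrite mem_set.
by rewrite memNset//; exact/negP.
Qed.

Lemma measurable_indic_ball d (T : measurableType d) n (G : T -> 'rV[R]_n) :
  mx_measurable G -> measurable_fun setT (fun t => \1_(B n) (G t) : R).
Proof.
move=> mG; apply: (measurableT_comp (f := \1_(B n) : _ -> R)).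
  by apply: measurable_indic; exact: measurable_euclidean_ball.
exact: mx_measurable_fun.
Qed.

Lemma measurable_cube n (r : R) : measurable (cube n r).
Proof.
rewrite (_ : cube n r = \bigcap_(i in [set: 'I_n])
    ((fun x : 'rV[R]_n => `|x ord0 i|%R) @^-1` `]-oo, r])).
  apply: fin_bigcap_measurable => // i _; rewrite -[X in measurable X]setTI.
  have : measurable_fun setT (fun x : 'rV[R]_n => `|x ord0 i|%R).
    by apply: measurableT_comp => //; exact: measurable_coord.
  by apply => //; exact: measurable_itv.
apply/seteqP; split=> [x xr i _|x xr i]; first by rewrite /= in_itv/= xr.
by have := xr i I; rewrite /= in_itv.
Qed.

Lemma lebesgue_rV_cube n (r : R) : (0 <= r)%R -> lam n (cube n r) = ((r *+ 2) ^+ n)%:E.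
Proof.
move=> r0; elim: n => [|n IH].
  by rewrite /= diracE expr0 mem_set// => -[].
have indE a v : \1_(cube n.+1 r) (cons_rV (a, v)) =
    (\1_`[- r, r] a * \1_(cube n r) v)%R :> R.
  rewrite !indicE -natrM mulnb; congr ((nat_of_bool _)%:R); apply/idP/idP.
    rewrite inE => h; apply/andP; split; rewrite inE/=.
      by have := h ord0; rewrite mxE unlift_none in_itv/= -ler_norml.
    by move=> i; have := h (lift ord0 i); rewrite mxE liftK.
  move=> /andP[/set_mem/=]; rewrite in_itv/= -ler_norml => ar /set_mem vr; apply: mem_set => i.
  by rewrite mxE; case: unlift.
have mi p : measurable_fun setT (fun x => (\1_(cube p r) x)%:E : \bar R).
  by apply/measurable_EFinP/measurable_indic; exact: measurable_cube.
rewrite -[cube n.+1 r]setIT -integral_indic//; last exact: measurable_cube.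
rewrite ge0_integral_cons//.
transitivity (\int[lebesgue_measure]_a ((\1_`[- r, r] a)%:E * lam n (cube n r))).
  apply: eq_integral => a _.
  rewrite -[X in _ * lam n X]setIT -integral_indic//; last exact: measurable_cube.
  rewrite -ge0_integralZl_EFin//.
  by apply: eq_integral => v _; rewrite indE EFinM.
rewrite IH; under eq_integral do rewrite muleC.
rewrite ge0_integralZl_EFin//; first last.
- by rewrite exprn_ge0// mulrn_wge0.
- by apply/measurable_EFinP/measurable_indic; exact: measurable_itv.
rewrite integral_indic ?setIT//.
rewrite [X in _ * X](_ : _ = (r *+ 2)%:E) -?EFinM ?exprSr//.
refine (etrans (lebesgue_measure_itv `[(- r)%R, r]) _); rewrite /= lte_fin.
case: ifPn => [_|]; first by rewrite -EFinD opprK mulr2n.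
rewrite -leNgt => rr; congr EFin; rewrite mulr2n; lra.
Qed.

Lemma lebesgue_rV_ball_gt0 n : 0 < lam n (B n).
Proof.
(* The cube of half-side [1 / (n + 1)] lies in the ball, because [n / (n + 1)^2] is at most 1. *)
pose r : R := (n.+1%:R^-1)%R; have r0 : (0 < r)%R by rewrite invr_gt0 ltr0n.
apply: (@lt_le_trans _ _ (lam n (cube n r))).
  by rewrite lebesgue_rV_cube ?(ltW r0)// lte_fin exprn_gt0// mulrn_wgt0.
apply: le_measure; rewrite ?inE; [exact: measurable_cube|exact: measurable_euclidean_ball|].
move=> x xr; rewrite /euclidean_ball/= /euclidean_norm -[leRHS]sqrtr1 ler_sqrt//.
apply: (@le_trans _ _ (\sum_(i < n) r ^+ 2)%R).
  apply: ler_sum => i _; rewrite -real_normK ?num_real//.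
  by rewrite lerXn2r ?nnegrE ?(ltW r0).
rewrite sumr_const card_ord -mulr_natr /r exprVn.
rewrite ler_pdivrMl ?exprn_gt0 ?ltr0n// mulr1 -natrX ler_nat.
by rewrite expnS expn1; nia.
Qed.

Lemma lebesgue_rV_ball_fin_num n : lam n (B n) \is a fin_num.
Proof.
rewrite ge0_fin_numE//; apply: (@le_lt_trans _ _ (lam n (cube n 1))).
  apply: le_measure; rewrite ?inE; [exact: measurable_euclidean_ball|exact: measurable_cube|].
  by move=> x x1 i; exact: (le_trans (ler_coord_euclidean_norm _ _)).
by rewrite lebesgue_rV_cube// ltry.
Qed.

Definition ball_volume n : R := fine (lam n (B n)).

Lemma lebesgue_rV_ball n : lam n (B n) = (ball_volume n)%:E.
Proof. by rewrite fineK// lebesgue_rV_ball_fin_num. Qed.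

Lemma ball_volume_gt0 n : (0 < ball_volume n)%R.
Proof. by rewrite -lte_fin -lebesgue_rV_ball lebesgue_rV_ball_gt0. Qed.

Lemma integral_indic_ball n : \int[lam n]_x (\1_(B n) x)%:E = (ball_volume n)%:E.
Proof.
rewrite integral_indic ?setIT//; last exact: measurable_euclidean_ball.
exact: lebesgue_rV_ball.
Qed.

End ball_volume.

Section ball_product.
Context {R : realType}.
Local Open Scope ereal_scope.
Local Notation lam := (lebesgue_rV R).
Local Notation B n := (euclidean_ball R n).
Local Notation vol := (@ball_volume R).

Definition ball_prod m n (X : 'M[R]_(m, n)) : R := (\prod_(i < m) \1_(B n) (row i X))%R.

Lemma ball_prod_ge0 m n (X : 'M[R]_(m, n)) : (0 <= ball_prod X)%R.
Proof. by apply: prodr_ge0 => i _; rewrite indicE. Qed.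

Lemma measurable_ball_prod d (T : measurableType d) m n (G : T -> 'M[R]_(m, n)) :
  mx_measurable G -> measurable_fun setT (fun t => ball_prod (G t)).
Proof.
move=> mG; apply: measurable_prod => i _; apply: measurable_indic_ball.
exact: mx_measurable_row.
Qed.

Lemma ball_prod_col_mx m n (x : 'rV[R]_n) (X : 'M[R]_(m, n)) :
  ball_prod (col_mx x X) = (\1_(B n) x * ball_prod X)%R.
Proof.
rewrite /ball_prod big_split_ord/= big_ord1 (rowKu ord0 x X) row_id.
by congr (_ * _)%R; apply: eq_bigr => i _; rewrite rowKd.
Qed.

Lemma indic_ball_mulmx m n (U : 'M[R]_(m, n)) (x : 'rV[R]_m) :
  U *m U^T = 1%:M -> \1_(B n) (x *m U) = \1_(B m) x :> R.
Proof. by move=> UU; rewrite !indic_ball euclidean_norm_mulmx. Qed.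

Lemma ball_prod_mulmx p m n (U : 'M[R]_(m, n)) (X : 'M[R]_(p, m)) :
  U *m U^T = 1%:M -> ball_prod (X *m U) = ball_prod X.
Proof.
by move=> UU; apply: eq_bigr => i _; rewrite row_mul indic_ball_mulmx.
Qed.

Lemma mx_integral_ball_prod m n :
  mx_integral (fun X : 'M[R]_(m, n) => (ball_prod X)%:E) = (vol n ^+ m)%:E.
Proof.
have mb p : matrix_measurable (fun X : 'M[R]_(p, n) => (ball_prod X)%:E).
  by apply/measurable_EFinP/measurable_ball_prod; mx_measurability.
elim: m => [|m IH]; first by rewrite mx_integral0// /ball_prod big_ord0.
rewrite (mx_integralS (m := m))//; last by move=> X; rewrite lee_fin ball_prod_ge0.
transitivity (\int[lam n]_x ((vol n ^+ m)%:E * (\1_(B n) x)%:E)).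
  apply: eq_integral => x _; rewrite -IH muleC -mx_integralZl//.
    by apply: eq_mx_integral => X; rewrite ball_prod_col_mx EFinM.
  by move=> X; rewrite lee_fin ball_prod_ge0.
rewrite ge0_integralZl_EFin//; first last.
- by rewrite exprn_ge0// ltW// ball_volume_gt0.
- apply/measurable_EFinP; apply: (measurable_indic_ball (G := fun x => x)).
  exact: mx_measurable_id.
by rewrite integral_indic_ball -EFinM -exprSr.
Qed.

End ball_product.

Section radial.
Context {R : realType}.
Local Open Scope ereal_scope.
Local Notation lam := (lebesgue_rV R).
Local Notation mu := (@lebesgue_measure R).
Local Notation B n := (euclidean_ball R n).
Local Notation vol := (@ball_volume R).

Lemma integral_exprn p (s : R) : (0 <= s <= 1)%R ->
  \int[mu]_(x in `[s, 1%R]) (p.+1%:R * x ^+ p)%:E = (1 - s ^+ p.+1)%:E.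
Proof.
move=> /andP[s0]; rewrite le_eqVlt => /orP[/eqP->|s1].
  by rewrite set_itv1 integral_set1 expr1n subrr.
have cX q : continuous (fun x : R => x ^+ q)%R by exact: exprn_continuous.
rewrite (@continuous_FTC2 _ _ (fun x => x ^+ p.+1)%R)//.
- by rewrite expr1n EFinB.
- apply: continuous_in_subspaceT => x _.
  by apply: cvgM; [exact: cvg_cst|exact: cX].
- split.
  + by move=> x _; exact: exprn_derivable.
  + by apply: cvg_at_right_filter; exact: cX.
  + by apply: cvg_at_left_filter; exact: cX.
- by move=> x _; rewrite exp_derive1.
Qed.

(** Layer-cake argument: on the ball, 1 is [|a|^(p+1)] plus the integral of [(p+1) r^p] over [r]
    from [|a|] to 1. Integrating over [a] first, the ball of radius [r] has volume [r^m] times that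
    of the unit ball, and the last term becomes [(p+1) / (m+p+1)] times the volume. *)
Lemma integral_ball_norm m p :
  \int[lam m]_x (\1_(B m) x * euclidean_norm x ^+ p.+1)%:E =
  (m%:R / (m + p.+1)%:R * vol m)%:E.
Proof.
pose f (r : R) : R := (p.+1%:R * r ^+ p)%R.
have mf : measurable_fun setT f.
  by apply: measurable_funM => //; apply: measurable_funX.
pose G (a : 'rV[R]_m) (r : measurableTypeR R) : \bar R :=
  (f r * \1_`]0%R, 1%R] r * \1_`[0%R, +oo[ (r - euclidean_norm a))%:E.
have GE a r : G a r = if (0 < r <= 1)%R && (euclidean_norm a <= r)%R
    then (f r)%:E else 0.
  rewrite /G !indicE !mem_setE !in_itv/= andbT subr_ge0.
  by case: (0 < r <= 1)%R; case: (_ <= r)%R; rewrite ?(mulr0, mulr1, mul0r).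
have G0 a r : 0 <= G a r.
  rewrite GE; case: ifP => // /andP[/andP[r0 _] _].
  by rewrite lee_fin mulr_ge0// exprn_ge0// ltW.
have mn : measurable_fun setT (@euclidean_norm R m).
  by apply: (measurable_euclidean_norm (G := id)); exact: mx_measurable_id.
have mI (i : interval R) : measurable_fun setT (\1_[set` i] : R -> R).
  by apply: measurable_indic; exact: measurable_itv.
have mG : measurable_fun setT (fun q : 'rV[R]_m * measurableTypeR R => G q.1 q.2).
  apply/measurable_EFinP; apply: measurable_funM.
    apply: measurable_funM.
      exact: (measurableT_comp mf measurable_snd).
    exact: (measurableT_comp (mI _) measurable_snd).
  apply: (measurableT_comp (mI _)); apply: measurable_funB => //.
  exact: (measurableT_comp mn measurable_fst).
have IG a : (\1_(B m) a)%:E =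
    (\1_(B m) a * euclidean_norm a ^+ p.+1)%:E + \int[mu]_r G a r.
  have a0 := euclidean_norm_ge0 a.
  rewrite indic_ball; case: ifPn => [a1|]; last first.
    rewrite -ltNge => a1; rewrite mul0r add0e integral0_eq// => r _.
    rewrite GE; case: ifP => // /andP[/andP[_ r1] ar].
    by have := lt_le_trans a1 (le_trans ar r1); rewrite ltxx.
  (* [G] keeps only [r > 0], so that division by [r] is possible below; the interval of integration
     is therefore open on the left exactly when [a] is the origin. *)
  pose b := euclidean_norm a == 0%R.
  have -> : \int[mu]_r G a r =
      \int[mu]_(r in [set` Interval (BSide (~~ b) (euclidean_norm a)) (BRight 1%R)])
        (f r)%:E.
    rewrite [RHS]integral_mkcond; apply: eq_integral => r _.
    rewrite GE patchE mem_setE /b.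
    have [->|na] := eqVneq (euclidean_norm a) 0%R => /=; rewrite in_itv/=.
      by case: (ltP 0%R r) => //= r0; rewrite (ltW r0) andbT.
    have a0' : (0 < euclidean_norm a)%R by rewrite lt_def na.
    have [ar|] := leP (euclidean_norm a) r; last by rewrite andbF.
    by rewrite andbT (lt_le_trans a0' ar).
  have -> : \int[mu]_(r in [set` Interval (BSide (~~ b) (euclidean_norm a)) (BRight 1%R)])
        (f r)%:E = \int[mu]_(r in `[euclidean_norm a, 1%R]) (f r)%:E.
    case: b => //; apply: integral_itv_obnd_cbnd.
    by apply/measurable_EFinP; exact: measurable_funS mf.
  by rewrite integral_exprn ?a0// mul1r -EFinD addrC subrK.
have IH r : \int[lam m]_a G a r =
    (vol m * p.+1%:R / (m + p.+1)%:R)%:E *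
    (\1_`]0%R, 1%R] r * ((m + p.+1)%:R * r ^+ (m + p)))%:E.
  have [/andP[r0 r1]|nr] := boolP (0 < r <= 1)%R; last first.
    rewrite indicE mem_setE in_itv/= (negbTE nr) mul0r mule0 integral0_eq// => a _.
    by rewrite GE (negbTE nr).
  transitivity (\int[lam m]_a ((f r)%:E * (\1_(B m) (r^-1 *: a))%:E)).
    apply: eq_integral => a _; rewrite GE r0 r1/= indic_ball euclidean_normZ.
    rewrite gtr0_norm ?invr_gt0// ler_pdivrMl// mulr1.
    by case: ifP; rewrite ?mule1 ?mule0.
  have f0 : (0 <= f r)%R by rewrite mulr_ge0// exprn_ge0// ltW.
  have mB : measurable_fun setT (fun a : 'rV[R]_m => (\1_(B m) a)%:E : \bar R).
    apply/measurable_EFinP; apply: (measurable_indic_ball (G := fun x => x)).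
    exact: mx_measurable_id.
  rewrite ge0_integralZl_EFin//; last first.
    apply/measurable_EFinP; apply: measurable_indic_ball.
    by apply: mx_measurableZ => //; exact: mx_measurable_id.
  rewrite (ge0_integral_rVZ (f := fun a => (\1_(B m) a)%:E))//; last first.
    by rewrite invr_neq0// gt_eqF.
  rewrite integral_indic_ball -!EFinM indicE mem_setE in_itv/= r0 r1 mul1r.
  rewrite normfV exprVn invrK gtr0_norm// /f exprD; congr EFin.
  have : ((m + p.+1)%:R != 0 :> R)%R by rewrite pnatr_eq0 addnS.
  by move: (m + p.+1)%:R%R => N N0; field.
have IV : (vol m)%:E = \int[lam m]_x (\1_(B m) x * euclidean_norm x ^+ p.+1)%:E +
    (vol m * p.+1%:R / (m + p.+1)%:R)%:E.
  rewrite -[LHS]integral_indic_ball (eq_integral _ _ (fun a _ => IG a)).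
  rewrite ge0_integralD//; last 4 first.
  - by move=> a _; rewrite lee_fin mulr_ge0 ?indicE// exprn_ge0// euclidean_norm_ge0.
  - apply/measurable_EFinP; apply: measurable_funM; last exact: measurable_funX.
    by apply: (measurable_indic_ball (G := fun x => x)); exact: mx_measurable_id.
  - by move=> a _; exact: integral_ge0.
  - exact: (measurable_fun_fubini_tonelli_F (fun q => G q.1 q.2)).
  congr (_ + _); rewrite (fubini_tonelli (fun q => G q.1 q.2))//.
  rewrite (eq_integral _ _ (fun r _ => IH r)).
  have mE q : measurable_fun setT
      (fun r : R => (\1_`]0%R, 1%R] r * (q%:R * r ^+ (m + p)))%:E).
    apply/measurable_EFinP; apply: measurable_funM => //.
    by apply: measurable_funM => //; exact: measurable_funX.
  rewrite ge0_integralZl_EFin//; first last.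
  - by rewrite divr_ge0// mulr_ge0// ltW// ball_volume_gt0.
  - exact: mE.
  - move=> r _; rewrite lee_fin indicE mem_setE in_itv/=.
    by case: (boolP (0 < r <= 1)%R) => [/andP[r0 _]|_]; rewrite ?mul0r// mul1r mulr_ge0// exprn_ge0// ltW.
  rewrite -[RHS]mule1; congr (_ * _).
  have := @integral_exprn (m + p) 0%R; rewrite lexx ler01 expr0n/= subr0 => /(_ isT) <-.
  rewrite -integral_itv_obnd_cbnd; last first.
    by apply/measurable_EFinP; apply: measurable_funM => //; exact: measurable_funX.
  rewrite [RHS]integral_mkcond; apply: eq_integral => r _.
  rewrite patchE indicE mem_setE in_itv/= addnS.
  by case: (boolP (0 < r <= 1)%R) => _; rewrite ?mul1r ?mul0r.
have := congr1 (fun z => z - (vol m * p.+1%:R / (m + p.+1)%:R)%:E) IV.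
rewrite addeK// -EFinB => <-; congr EFin.
have : ((m + p.+1)%:R != 0 :> R)%R by rewrite pnatr_eq0 addnS.
by rewrite natrD => N0; field.
Qed.

End radial.

Section young.
Context {R : realType}.

(** The difference of the two sides for [n + 1] is [y] times the difference for [n], plus
    [(n + 1) x^n (x - y)^2]. *)
Lemma Young_exprn n (x y : R) : 0 <= x -> 0 <= y ->
  n.+1%:R * (x ^+ n * y) <= n%:R * x ^+ n.+1 + y ^+ n.+1.
Proof.
move=> x0 y0; elim: n => [|n IH]; first by rewrite expr0 !expr1 !mul1r mul0r add0r.
have := ler_wpM2r y0 IH.
have h : 0 <= n.+1%:R * (x ^+ n * (x - y) ^+ 2).
  by rewrite mulr_ge0// mulr_ge0 ?sqr_ge0 ?exprn_ge0.
rewrite -subr_ge0 => IHy; rewrite -subr_ge0; apply: le_trans (addr_ge0 h IHy) _.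
rewrite le_eqVlt; apply/orP; left; apply/eqP.
by rewrite !exprS -!natr1; ring.
Qed.

(** Replacing [x] by [t * x] and [y] by [t ^- n * y], where [t ^+ n.+1 = s], leaves [x ^+ n * y]
    unchanged and redistributes the weight between the two terms. *)
Lemma Young_weighted n (s x y : R) : 0 < s -> 0 <= x -> 0 <= y ->
  x ^+ n * y <= n.+1%:R^-1 * (n%:R * s * x ^+ n.+1 + s ^- n * y ^+ n.+1).
Proof.
move=> s0 x0 y0; pose t := s `^ n.+1%:R^-1.
have t0 : 0 < t by rewrite powR_gt0.
have ts : t ^+ n.+1 = s.
  by rewrite -powR_mulrn ?ltW// -powRrM mulVf ?pnatr_eq0// powRr1// ltW.
rewrite ler_pdivlMl ?ltr0n//.
have := @Young_exprn n (t * x) (t ^- n * y).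
rewrite mulr_ge0 ?(ltW t0)// mulr_ge0 ?invr_ge0 ?exprn_ge0 ?(ltW t0)// => /(_ isT isT).
have tn : (t ^- n) ^+ n.+1 = s ^- n by rewrite exprVn -exprM mulnC exprM ts.
by rewrite !exprMn ts tn mulrACA mulfV ?mul1r ?expf_neq0 ?gt_eqF// [_%:R * (s * _)]mulrA.
Qed.

End young.

(** * Averages over the chart *)

Section sections_average.
Context {R : realType}.
Local Open Scope ereal_scope.
Local Notation lam := (lebesgue_rV R).
Local Notation B n := (euclidean_ball R n).
Local Notation vol := (@ball_volume R).

(** The volume of the parallelepiped spanned by the rows, written [D] in the overview. *)
Definition gram m n (W : 'M[R]_(m, n)) : R := Num.sqrt (\det (W *m W^T)).

Lemma gram_mulmx m n (A : 'M[R]_m) (U : 'M[R]_(m, n)) :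
  U *m U^T = 1%:M -> gram (A *m U) = `|\det A|%R.
Proof.
move=> UU; rewrite /gram trmx_mul mulmxA -(mulmxA A) UU mulmx1 det_mulmx det_tr.
by rewrite -expr2 sqrtr_sqr.
Qed.

Lemma gram_ge0 m n (W : 'M[R]_(m, n)) : (0 <= gram W)%R.
Proof. exact: sqrtr_ge0. Qed.

Lemma measurable_gramV d (T : measurableType d) m n (G : T -> 'M[R]_(m, n)) :
  mx_measurable G -> measurable_fun setT (fun t => (gram (G t))^-1%R).
Proof.
move=> mG; rewrite (_ : (fun _ => _) = (fun t => gram (G t) `^ (-1)))%R; last first.
  by apply/funext => t; rewrite powR_inv1// gram_ge0.
apply: (measurableT_comp (@measurable_powR R (-1)%R)).
apply: (measurableT_comp (f := @Num.sqrt R)).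
  by apply: continuous_measurable_fun; exact: sqrt_continuous.
by apply: measurable_det; mx_measurability.
Qed.

Lemma row_free_graph m k (S : 'M[R]_(m + k)) (Z : 'M[R]_(m, k)) :
  S \in unitmx -> row_free (row_mx 1%:M Z *m S).
Proof.
move=> uS; apply/row_freeP; exists (invmx S *m col_mx 1%:M 0).
by rewrite mulmxA mulmxK// mul_row_col mulmx1 mulmx0 addr0.
Qed.

Variables (p k : nat) (k_gt0 : (0 < k)%N).
Local Notation m := (1 + p)%N.

Let w (A : 'M[R]_m) : R := (`|\det A| ^+ k * ball_prod A)%R.

Let w_ge0 A : (0 <= w A)%R.
Proof. by rewrite mulr_ge0 ?exprn_ge0 ?ball_prod_ge0. Qed.

Let measurable_absdet d (T : measurableType d) (G : T -> 'M[R]_m) :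
  mx_measurable G -> measurable_fun setT (fun t => `|\det (G t)| ^+ k)%R.
Proof.
move=> mG; apply: measurable_funX.
by apply: measurableT_comp => //; exact: measurable_det.
Qed.

Let measurable_w d (T : measurableType d) (G : T -> 'M[R]_m) :
  mx_measurable G -> measurable_fun setT (fun t => w (G t)).
Proof.
move=> mG; apply: measurable_funM; first exact: measurable_absdet.
exact: measurable_ball_prod.
Qed.

Definition ball_det_integral : \bar R :=
  mx_integral (fun A : 'M[R]_m => (`|\det A| ^+ k * ball_prod A)%:E).

(** The first row [a] is not confined to the ball, which makes this a homogeneous function of [a].
    Its value at a unit vector is the constant [b] of the overview. *)
Definition ball_det_slice (a : 'rV[R]_m) : \bar R :=
  mx_integral (fun A : 'M[R]_(p, m) => (`|\det (col_mx a A)| ^+ k * ball_prod A)%:E).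

Lemma ball_det_slice_ge0 a : 0 <= ball_det_slice a.
Proof.
by apply: mx_integral_ge0 => A; rewrite lee_fin mulr_ge0 ?exprn_ge0 ?ball_prod_ge0.
Qed.

Lemma ball_det_slice_mulmx (Q : 'M[R]_m) a :
  Q *m Q^T = 1%:M -> ball_det_slice (a *m Q) = ball_det_slice a.
Proof.
move=> QQ; pose F (A : 'M[R]_(p, m)) : \bar R :=
  (`|\det (col_mx (a *m Q) A)| ^+ k * ball_prod A)%:E.
have mF : matrix_measurable F.
  apply/measurable_EFinP; apply: measurable_funM.
    by apply: measurable_absdet; mx_measurability.
  by apply: measurable_ball_prod; mx_measurability.
have F0 A : 0 <= F A by rewrite lee_fin mulr_ge0 ?exprn_ge0 ?ball_prod_ge0.
have := mx_integral_mulr mF F0 (orthogonal_unitmx QQ).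
rewrite (orthogonal_det QQ) expr1n invr1 mul1e => FE.
transitivity (mx_integral F); first by [].
rewrite -FE.
apply: eq_mx_integral => A; rewrite /F ball_prod_mulmx// -mul_col_mx det_mulmx.
by rewrite normrM (orthogonal_det QQ) mulr1.
Qed.

Lemma ball_det_sliceZ c a :
  ball_det_slice (c *: a) = (`|c| ^+ k)%:E * ball_det_slice a.
Proof.
rewrite /ball_det_slice -mx_integralZl ?exprn_ge0//; last first.
- by move=> A; rewrite lee_fin mulr_ge0 ?exprn_ge0 ?ball_prod_ge0.
- apply/measurable_EFinP; apply: measurable_funM.
    by apply: measurable_absdet; mx_measurability.
  by apply: measurable_ball_prod; mx_measurability.
apply: eq_mx_integral => A; rewrite -EFinM mulrA -exprMn -normrM; congr (_ ^+ _ * _)%:E.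
congr `|_|%R.
have -> : col_mx (c *: a) A = block_mx c%:M 0 0 1%:M *m col_mx a A.
  by rewrite mul_block_col !mul0mx addr0 add0r mul1mx mul_scalar_mx.
by rewrite det_mulmx det_ublock det_scalar1 det1 mulr1.
Qed.

Let e0 : 'rV[R]_m := delta_mx ord0 ord0.

Let e0_norm : euclidean_norm e0 = 1%R.
Proof.
rewrite /euclidean_norm (bigD1 ord0)//= big1 => [|i i0].
  by rewrite addr0 mxE !eqxx expr1n sqrtr1.
by rewrite mxE (negbTE i0) andbF expr0n.
Qed.

(** The slice is invariant under orthogonal matrices, which are transitive on the unit sphere, and
    homogeneous of degree [k] in its argument. *)
Lemma ball_det_sliceE a :
  ball_det_slice a = (euclidean_norm a ^+ k)%:E * ball_det_slice e0.
Proof.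
have [->|a0] := eqVneq a 0%R.
  rewrite euclidean_norm0 -[X in ball_det_slice X](scale0r 0%R) ball_det_sliceZ.
  by rewrite normr0 expr0n (gtn_eqF k_gt0) !mul0e.
have na : (euclidean_norm a != 0)%R by rewrite euclidean_norm_eq0.
have u1 : euclidean_norm ((euclidean_norm a)^-1 *: a)%R = 1%R.
  by rewrite euclidean_normZ ger0_norm ?mulVf// invr_ge0 euclidean_norm_ge0.
have [Q [QQ _ eQ]] := orthogonal_transitive e0_norm u1.
rewrite -(ball_det_slice_mulmx e0 QQ) eQ ball_det_sliceZ muleA -EFinM.
rewrite ger0_norm ?invr_ge0 ?euclidean_norm_ge0// -exprMn mulfV//.
by rewrite expr1n mul1e.
Qed.

(** Integrating the slice over its first row leaves the moment of [|a|^k] over the ball, the source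
    of the factor [m / (m + k)]. *)
Lemma ball_det_integralE : ball_det_integral =
  (m%:R / (m + k)%:R * vol m)%:E * ball_det_slice e0.
Proof.
have mF : matrix_measurable (fun A : 'M[R]_m => (w A)%:E).
  by apply/measurable_EFinP/measurable_w; mx_measurability.
rewrite /ball_det_integral (mx_integralS (m := p))//.
transitivity (\int[lam m]_a ((\1_(B m) a * euclidean_norm a ^+ k)%:E * ball_det_slice e0)).
  apply: eq_integral => a _; rewrite EFinM -muleA -ball_det_sliceE.
  rewrite /ball_det_slice -mx_integralZl//; last first.
  - by move=> A; rewrite lee_fin mulr_ge0 ?exprn_ge0 ?ball_prod_ge0.
  - apply/measurable_EFinP; apply: measurable_funM.
      by apply: measurable_absdet; mx_measurability.
    by apply: measurable_ball_prod; mx_measurability.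
  by apply: eq_mx_integral => A; rewrite ball_prod_col_mx -EFinM mulrCA.
rewrite ge0_integralZr//; last 3 first.
- apply/measurable_EFinP; apply: measurable_funM; last first.
    apply: measurable_funX.
    by apply: (measurable_euclidean_norm (G := fun x => x)); exact: mx_measurable_id.
  by apply: (measurable_indic_ball (G := fun x => x)); exact: mx_measurable_id.
- by move=> a _; rewrite lee_fin mulr_ge0 ?indicE// exprn_ge0// euclidean_norm_ge0.
- exact: ball_det_slice_ge0.
by rewrite -[k]prednK// integral_ball_norm.
Qed.

(** With [W = C *m U] and [U] orthonormal, substitute [A *m C] for [A]: the Jacobian accounts for
    [m] of the powers of [D(W)], and the weight [|\det A| ^+ k] for the other [k]. *)
Lemma integral_ball_det_graph (W : 'M[R]_(m, m + k)) : row_free W ->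
  mx_integral (fun A : 'M[R]_m => (`|\det A| ^+ k)%:E * (ball_prod (A *m W))%:E) =
  ((gram W)^-1 ^+ (m + k))%:E * ball_det_integral.
Proof.
move=> /Gram_Schmidt[C [U [uC UU ->]]]; rewrite gram_mulmx//.
have dC : (`|\det C| != 0)%R by rewrite normr_eq0 -unitfE -unitmxE.
have mF : matrix_measurable (fun A : 'M[R]_m => (w A)%:E).
  by apply/measurable_EFinP/measurable_w; mx_measurability.
rewrite exprD [in RHS]mulrC EFinM -muleA [in X in _ = _ * X]exprVn.
rewrite /ball_det_integral -(mx_integral_mulr mF)// -mx_integralZl ?exprn_ge0 ?invr_ge0//; last 2 first.
- by apply/measurable_EFinP/measurable_w; mx_measurability.
- by move=> A; rewrite lee_fin w_ge0.
apply: eq_mx_integral => A; rewrite -!EFinM mulmxA ball_prod_mulmx// /w det_mulmx.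
rewrite normrM exprMn exprVn; congr EFin.
have : (`|\det C| ^+ k != 0)%R by rewrite expf_neq0.
by move: (`|\det C| ^+ k)%R => c c0; field.
Qed.

(** Both sides compute the integral of [ball_prod (X *m S)]: the right one by the substitution
    [X *m S], the left one in the chart. *)
Lemma integral_sections_average (S : 'M[R]_(m + k)) : S \in unitmx ->
  mx_integral (fun Z : 'M[R]_(m, k) => ((gram (row_mx 1%:M Z *m S))^-1 ^+ (m + k))%:E)
    * ball_det_integral = (`|\det S| ^- m * vol (m + k) ^+ m)%:E.
Proof.
move=> uS.
have mF : matrix_measurable (fun X : 'M[R]_(m, m + k) => (ball_prod (X *m S))%:E).
  by apply/measurable_EFinP/measurable_ball_prod; mx_measurability.
have mQ : matrix_measurable (fun X : 'M[R]_(m, m + k) => (ball_prod X)%:E).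
  by apply/measurable_EFinP/measurable_ball_prod; mx_measurability.
rewrite EFinM -mx_integral_ball_prod -(mx_integral_mulr mQ)//; last first.
  by move=> X; rewrite lee_fin ball_prod_ge0.
rewrite [RHS]mx_integral_chart//; last by move=> X; rewrite lee_fin ball_prod_ge0.
rewrite -mx_integralZr; last 3 first.
- apply/measurable_EFinP; apply: measurable_funX; apply: measurable_gramV.
  by mx_measurability.
- by move=> Z; rewrite lee_fin exprn_ge0// invr_ge0 gram_ge0.
- by apply: mx_integral_ge0 => A; rewrite lee_fin w_ge0.
apply: eq_mx_integral => Z; rewrite -integral_ball_det_graph; last exact: row_free_graph.
by apply: eq_mx_integral => A; rewrite mulmxA.
Qed.

End sections_average.

(** A zero factor would make the product zero, and an infinite factor times a positive one is
    infinite. This gives finiteness of integrals that are known only through a product. *)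
Lemma mule_eq_fin_gt0 (R : realType) (x y : \bar R) (r : R) :
  (0 <= x)%E -> (0 <= y)%E -> 0 < r -> (x * y = r%:E)%E ->
  exists a b : R, [/\ x = a%:E, y = b%:E, 0 < a, 0 < b & a * b = r].
Proof.
move=> x0 y0 r0 xyr.
have xN0 : x != 0%E by apply: contra_eq_neq xyr => ->; rewrite mul0e eqe lt_eqF.
have yN0 : y != 0%E by apply: contra_eq_neq xyr => ->; rewrite mule0 eqe lt_eqF.
have {x0 xN0}x0 : (0 < x)%E by rewrite lt_def xN0.
have {y0 yN0}y0 : (0 < y)%E by rewrite lt_def yN0.
case: x y x0 y0 xyr => [a||] [b||]//=; rewrite ?lte_fin.
- by move=> a0 b0; rewrite -EFinM => -[ab]; exists a, b.
- by move=> a0 _; rewrite gt0_muley// lte_fin.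
- by move=> _ b0; rewrite gt0_mulye// lte_fin.
Qed.

Section slicing_inequality.
Context {R : realType}.
Local Open Scope ereal_scope.
Local Notation lam := (lebesgue_rV R).
Local Notation B n := (euclidean_ball R n).
Local Notation vol := (@ball_volume R).
Variables (p k : nat) (k_gt0 : (0 < k)%N).
Local Notation m := (1 + p)%N.
Local Notation n := (m + k)%N.
Local Notation e0 := (delta_mx ord0 ord0 : 'rV[R]_m).
Variables (h : 'rV[R]_n -> \bar R) (M : R).
Hypotheses (mh : measurable_fun setT h) (h0 : forall x, 0 <= h x).
Hypothesis sectionM : forall U : 'M[R]_(m, n), U *m U^T = 1%:M ->
  \int[lam m]_y h (y *m U) <= M%:E.

Let mx_measurable_usubmx d (T : measurableType d) q (G : T -> 'M[R]_(m, q)) :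
  mx_measurable G -> mx_measurable (fun t => usubmx (G t)).
Proof. by move=> mG i j; under eq_fun do rewrite mxE; exact: mG. Qed.

(** Orthonormalising [Y] turns the integral into a section integral, with Jacobian [1 / D(Y)]. *)
Let section_row_free (Y : 'M[R]_(m, n)) : row_free Y ->
  \int[lam m]_y h (y *m Y) <= ((gram Y)^-1)%:E * M%:E.
Proof.
move=> /Gram_Schmidt[C [U [uC UU ->]]]; rewrite gram_mulmx//.
under eq_integral do rewrite mulmxA.
rewrite (ge0_integral_mulmx (f := fun y => h (y *m U)))//; last first.
  by apply: (measurable_fun_rV_comp mh); mx_measurability.
by apply: lee_wpmul2l; rewrite ?sectionM// lee_fin invr_ge0.
Qed.

(** Orthonormalising [Y *m S] by [C] costs [D(YS)^(-n)] and moves [h] to the frame [invmx C *m Y].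
    The first row is then integrated last: its slice is at most the value at a unit vector, since
    [|a|^k <= 1] on the ball, and returning to the frame [Y] gives back one factor [D(YS)]. Hence
    the exponent [p + k], which is [n - 1]. *)
Let slice_bound (Y : 'M[R]_(m, n)) (S : 'M[R]_n) : row_free Y -> row_free (Y *m S) ->
  mx_integral (fun A : 'M[R]_m => (`|\det A| ^+ k)%:E *
     (h (usubmx (A *m Y)) * (ball_prod (A *m Y *m S))%:E)) <=
  ((gram (Y *m S))^-1 ^+ (p + k) * (gram Y)^-1)%:E * (ball_det_slice k e0 * M%:E).
Proof.
move=> fY /Gram_Schmidt[C [U [uC UU YS]]]; rewrite YS gram_mulmx//.
have dC : (`|\det C| != 0)%R by rewrite normr_eq0 -unitfE -unitmxE.
pose D := invmx C *m Y.
pose F (A : 'M[R]_m) : \bar R :=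
  (`|\det A| ^+ k * ball_prod A)%:E * h (usubmx A *m D).
have F0 A : 0 <= F A.
  by rewrite mule_ge0// lee_fin mulr_ge0 ?exprn_ge0 ?ball_prod_ge0.
have mF d (T : measurableType d) (G : T -> 'M[R]_m) : mx_measurable G ->
    measurable_fun setT (fun t => F (G t)).
  move=> mG; apply: emeasurable_funM.
    apply/measurable_EFinP; apply: measurable_funM; last exact: measurable_ball_prod.
    apply: measurable_funX; apply: measurableT_comp => //.
    exact: measurable_det.
  apply: (measurable_fun_rV_comp mh); apply: mx_measurableM.
    exact: mx_measurable_usubmx.
  exact: mx_measurable_cst.
have mF' : matrix_measurable F by apply: mF; mx_measurability.
have -> : mx_integral (fun A : 'M[R]_m => (`|\det A| ^+ k)%:E *
     (h (usubmx (A *m Y)) * (ball_prod (A *m Y *m S))%:E)) =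
  (`|\det C|^-1 ^+ n)%:E * mx_integral F.
  rewrite exprD mulrC EFinM -muleA [in X in _ * (X%:E * _)]exprVn.
  rewrite -(mx_integral_mulr mF')// -mx_integralZl ?exprn_ge0 ?invr_ge0//; last first.
    by apply: mF; mx_measurability.
  apply: eq_mx_integral => A; rewrite /F -mulmxA YS mulmxA ball_prod_mulmx//.
  rewrite -mul_usub_mx /D mulmxA -mul_usub_mx mulmxK// [in LHS]muleA muleAC.
  rewrite [in RHS]muleA -!EFinM; congr (_ * _); congr EFin.
  rewrite det_mulmx normrM exprMn exprVn.
  have : (`|\det C| ^+ k != 0)%R by rewrite expf_neq0.
  by move: (`|\det C| ^+ k)%R => c c0; field.
have beta0 := @ball_det_slice_ge0 R p k e0.
have mhD (E : 'M[R]_(m, n)) : measurable_fun setT (fun a : 'rV[R]_m => h (a *m E)).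
  by apply: (measurable_fun_rV_comp mh); mx_measurability.
have FB : mx_integral F <= ball_det_slice k e0 * \int[lam m]_a h (a *m D).
  rewrite (mx_integralS (m := p))//.
  rewrite muleC -ge0_integralZr//.
  apply: ge0_le_integral => //.
  - by move=> a _; exact: mx_integral_ge0.
  - apply: measurable_mx_integral => //.
    by apply: mF; mx_measurability.
  - exact: emeasurable_funM.
  move=> a _; rewrite muleC.
  have mG : matrix_measurable (fun A : 'M[R]_(p, m) =>
      (`|\det (col_mx a A)| ^+ k * ball_prod A)%:E).
    apply/measurable_EFinP; apply: measurable_funM.
      apply: measurable_funX; apply: measurableT_comp => //.
      by apply: measurable_det; mx_measurability.
    by apply: measurable_ball_prod; mx_measurability.
  have G0 (A : 'M[R]_(p, m)) : 0 <= (`|\det (col_mx a A)| ^+ k * ball_prod A)%:E.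
    by rewrite lee_fin mulr_ge0 ?exprn_ge0 ?ball_prod_ge0.
  have -> : mx_integral (fun X : 'M[R]_(p, m) => F (col_mx a X)) =
      (\1_(B m) a)%:E * ball_det_slice k a * h (a *m D).
    rewrite -mx_integralZl// /mx_integral -ge0_integralZr//.
    - apply: eq_integral => v _; rewrite /F col_mxKu ball_prod_col_mx.
      by rewrite mulrCA EFinM.
    - exact: measurable_funeM.
    - by move=> v _; rewrite mule_ge0// lee_fin.
  apply: lee_wpmul2r => //; rewrite ball_det_sliceE// muleA -EFinM.
  rewrite -[leRHS]mul1e; apply: lee_wpmul2r => //; rewrite lee_fin indic_ball.
  case: ifPn => [a1|_]; last by rewrite mul0r.
  by rewrite mul1r exprn_ile1// euclidean_norm_ge0.
have hD : \int[lam m]_a h (a *m D) <= `|\det C|%:E * ((gram Y)^-1%:E * M%:E).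
  under eq_integral do rewrite /D mulmxA.
  rewrite (ge0_integral_mulmx (f := fun a => h (a *m Y))) ?unitmx_inv//.
  rewrite det_inv normfV invrK; apply: lee_wpmul2l; first by rewrite lee_fin.
  exact: section_row_free.
apply: (@le_trans _ _ ((`|\det C|^-1 ^+ n)%:E * (ball_det_slice k e0 *
    (`|\det C|%:E * ((gram Y)^-1%:E * M%:E))))).
  apply: lee_wpmul2l; first by rewrite lee_fin exprn_ge0// invr_ge0.
  by apply: le_trans FB _; exact: lee_wpmul2l.
rewrite le_eqVlt; apply/orP; left; apply/eqP.
rewrite -[(_ ^+ n)%R]/((`|\det C|^-1) ^+ (p + k).+1)%R exprS.
rewrite -!EFinM muleCA -EFinM [RHS]muleCA -EFinM; congr (_ * _); congr EFin.
by move: ((gram Y)^-1)%R (`|\det C|^-1 ^+ (p + k))%R => y z; field.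
Qed.

Lemma slicing_inequality (S : 'M[R]_n) : S \in unitmx ->
  (forall x, ~ (euclidean_norm (x *m S) <= 1)%R -> h x = 0) ->
  \int[lam n]_x h x <=
  (n%:R / m%:R * (vol n / vol m) * (`|\det S|^-1 `^ (k%:R / n%:R)) * M)%:E.
Proof.
move=> uS hS; set tau := (`|\det S|^-1)%R.
have tau0 : (0 < tau)%R by rewrite invr_gt0 normr_gt0 -unitfE -unitmxE.
have V0 := @ball_volume_gt0 R n; have Vm0 := @ball_volume_gt0 R m.
pose Y (Z : 'M[R]_(m, k)) : 'M[R]_(m, n) := row_mx 1%:M Z.
have fY Z : row_free (Y Z).
  by rewrite -[Y Z]mulmx1 row_free_graph ?unitmx1.
pose P (Q : 'M[R]_n) := mx_integral (fun Z => ((gram (Y Z *m Q))^-1 ^+ n)%:E).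
have P0 Q : 0 <= P Q.
  by apply: mx_integral_ge0 => Z; rewrite lee_fin exprn_ge0// invr_ge0 gram_ge0.
have b0 := @ball_det_slice_ge0 R p k e0.
have PE Q : Q \in unitmx -> P Q * ((m%:R / n%:R * vol m)%:E * ball_det_slice k e0) =
    (`|\det Q| ^- m * vol n ^+ m)%:E.
  by move=> uQ; rewrite -ball_det_integralE// integral_sections_average.
have mVm0 : (0 < m%:R / n%:R * vol m)%R by rewrite mulr_gt0// divr_gt0// ltr0n.
have b0' : 0 <= (m%:R / n%:R * vol m)%:E * ball_det_slice k e0.
  by rewrite mule_ge0// lee_fin ltW.
have PE1 : P 1%:M * ((m%:R / n%:R * vol m)%:E * ball_det_slice k e0) =
    (vol n ^+ m)%:E.
  by rewrite PE ?unitmx1// det1 normr1 expr1n invr1 mul1r.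
(* The identity for [S = 1] shows that the integral [c] of [D(Y)^(-n)] and the moment [gm] are
   positive reals; [b] inherits this from [gm]. *)
have [c [gm [PcE gmE c0 gm0 cgm]]] :=
  mule_eq_fin_gt0 (P0 1%:M) b0' (exprn_gt0 m V0) PE1.
have mVm0' : 0 <= (m%:R / n%:R * vol m)%:E by rewrite lee_fin ltW.
have [_ [b [_ bE _ b_gt0 _]]] := mule_eq_fin_gt0 mVm0' b0 gm0 gmE.
have gmb : gm = (m%:R / n%:R * vol m * b)%R.
  by move: gmE; rewrite bE -EFinM => -[].
(* Comparing the identities for [S] and for 1 cancels the moment. *)
have PSE : P S = (tau ^+ m * c)%:E.
  have r0 : (0 < `|\det S| ^- m * vol n ^+ m)%R.
    by rewrite mulr_gt0 ?exprn_gt0// -exprVn exprn_gt0.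
  have [s [g [-> ]]] := mule_eq_fin_gt0 (P0 S) b0' r0 (PE _ uS).
  rewrite gmE => -[<-] s0 _ sg; congr EFin.
  by apply: (mulIf (negbT (gt_eqF gm0))); rewrite sg -mulrA cgm exprVn.
have Y1 Z : Y Z *m 1%:M = Y Z by rewrite mulmx1.
have mgY d (T : measurableType d) (f : T -> 'rV[R]_(m * k)) (Q : 'M[R]_n) :
    measurable_fun setT f ->
    measurable_fun setT (fun t => (gram (Y (mx_of_rV (f t)) *m Q))^-1%R).
  by move=> mf; rewrite /Y; apply: measurable_gramV; mx_measurability.
have M0 : 0 <= M%:E.
  apply: le_trans (sectionM (U := row_mx 1%:M 0) _); first exact: integral_ge0.
  by rewrite tr_row_mx mul_row_col trmx0 mulmx0 addr0 trmx1 mulmx1.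
have mbp : matrix_measurable (fun X : 'M[R]_(p, n) => (ball_prod X)%:E).
  by apply/measurable_EFinP/measurable_ball_prod; mx_measurability.
(* Each of the last [p] rows contributes the volume of the ellipsoid; the constraint on the first
   row is free, because [h] vanishes outside the ellipsoid. *)
have H1 : \int[lam n]_x h x * (tau ^+ p * vol n ^+ p)%:E =
    mx_integral (fun X : 'M[R]_(m, n) => h (usubmx X) * (ball_prod (X *m S))%:E).
  rewrite (mx_integralS (m := p)); last 2 first.
  - apply: emeasurable_funM.
      apply: (measurable_fun_rV_comp mh).
      by apply: mx_measurable_usubmx; mx_measurability.
    by apply/measurable_EFinP; apply: measurable_ball_prod; mx_measurability.
  - by move=> X; rewrite mule_ge0// lee_fin ball_prod_ge0.
  rewrite -ge0_integralZr//; last first.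
    by rewrite lee_fin mulr_ge0// exprn_ge0// ltW.
  apply: eq_integral => x _.
  rewrite /tau exprVn EFinM -mx_integral_ball_prod -(mx_integral_mulr mbp)//; last first.
    by move=> X; rewrite lee_fin ball_prod_ge0.
  have [xS|xS] := pselect (euclidean_norm (x *m S) <= 1)%R; last first.
    rewrite hS// mul0e /mx_integral integral0_eq// => v _.
    by rewrite col_mxKu hS// mul0e.
  rewrite muleC /mx_integral -ge0_integralZr//.
  - apply: eq_integral => v _; rewrite col_mxKu mul_col_mx ball_prod_col_mx.
    by rewrite indic_ball xS mul1r muleC.
  - by apply/measurable_EFinP; apply: measurable_ball_prod; mx_measurability.
  - by move=> v _; rewrite lee_fin ball_prod_ge0.
pose rho := (tau `^ (m%:R - m%:R / n%:R))%R.
have rho0 : (0 < rho)%R by rewrite powR_gt0.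
have n0 : (0 < n%:R :> R)%R by rewrite ltr0n.
pose J Z := ((gram (Y Z *m S))^-1 ^+ (p + k) * (gram (Y Z))^-1)%R.
have J0 Z : (0 <= J Z)%R by rewrite mulr_ge0 ?exprn_ge0 ?invr_ge0 ?gram_ge0.
have mJ : matrix_measurable (fun Z => (J Z)%:E).
  apply/measurable_EFinP; apply: measurable_funM.
    by apply: measurable_funX; exact: (mgY _ _ id).
  under eq_fun do rewrite -Y1.
  exact: (mgY _ _ id).
have H2 : mx_integral (fun X : 'M[R]_(m, n) => h (usubmx X) * (ball_prod (X *m S))%:E)
    <= mx_integral (fun Z => (J Z)%:E) * (b * M)%:E.
  have bM0 : (0 <= b * M)%R by rewrite mulr_ge0 ?(ltW b_gt0).
  have mF : matrix_measurable (fun X : 'M[R]_(m, n) =>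
      h (usubmx X) * (ball_prod (X *m S))%:E).
    apply: emeasurable_funM.
      apply: (measurable_fun_rV_comp mh).
      by apply: mx_measurable_usubmx; mx_measurability.
    by apply/measurable_EFinP; apply: measurable_ball_prod; mx_measurability.
  have F0 (X : 'M[R]_(m, n)) : 0 <= h (usubmx X) * (ball_prod (X *m S))%:E.
    by rewrite mule_ge0// lee_fin ball_prod_ge0.
  rewrite mx_integral_chart// muleC -mx_integralZl//.
  apply: le_mx_integral.
  - apply: measurable_mx_integral => //; last first.
      by move=> Z A; rewrite mule_ge0// lee_fin exprn_ge0.
    apply: emeasurable_funM.
      apply/measurable_EFinP; apply: measurable_funX; apply: measurableT_comp => //.
      by apply: measurable_det; mx_measurability.
    by apply: (matrix_measurable_comp mF); mx_measurability.
  - exact: measurable_funeM.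
  - by move=> Z; apply: mx_integral_ge0 => A; rewrite mule_ge0// lee_fin exprn_ge0.
  move=> Z; rewrite [leRHS]muleC [(b * M)%:E]EFinM -bE; apply: slice_bound; first exact: fY.
  exact: row_free_graph.
(* The weight that balances Young's inequality: [sigma * tau ^+ m] and [sigma ^- (p + k)] are both
   [rho], so the two integrals receive the same factor [rho * c] and their weights add up to 1. *)
pose sigma := (tau `^ (- (m%:R / n%:R)))%R.
have sigma0 : (0 < sigma)%R by rewrite powR_gt0.
have sigma_rho : (sigma * tau ^+ m = rho)%R.
  rewrite -powR_mulrn ?ltW// /sigma /rho -powRD 1?addrC//.
  by apply/implyP => _; rewrite gt_eqF.
have sigmaV_rho : (sigma ^- (p + k) = rho)%R.
  rewrite -exprVn /sigma -powRN opprK -powR_mulrn ?powR_ge0// -powRrM; congr powR.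
  have nE : (n%:R = (p + k)%:R + 1 :> R)%R by rewrite natr1.
  have : (n%:R != 0 :> R)%R by rewrite gt_eqF.
  by rewrite nE; move: m%:R (p + k)%:R => u v uv; field.
have H3 : mx_integral (fun Z => (J Z)%:E) <= (rho * c)%:E.
  pose T1 Z := ((gram (Y Z *m S))^-1 ^+ n)%:E; pose T2 Z := ((gram (Y Z))^-1 ^+ n)%:E.
  have T10 Z : 0 <= T1 Z by rewrite lee_fin exprn_ge0// invr_ge0 gram_ge0.
  have T20 Z : 0 <= T2 Z by rewrite lee_fin exprn_ge0// invr_ge0 gram_ge0.
  have mT1 : matrix_measurable T1.
    by apply/measurable_EFinP; apply: measurable_funX; exact: (mgY _ _ id).
  have mT2 : matrix_measurable T2.
    apply/measurable_EFinP; apply: measurable_funX.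
    by under eq_fun do rewrite -Y1; exact: (mgY _ _ id).
  have T2E : mx_integral T2 = c%:E.
    by rewrite -PcE; apply: eq_mx_integral => Z; rewrite Y1.
  pose a1 := (n%:R^-1 * ((p + k)%:R * sigma))%R; pose a2 := (n%:R^-1 * rho)%R.
  have a10 : (0 <= a1)%R by rewrite !mulr_ge0 ?invr_ge0// ltW.
  have a20 : (0 <= a2)%R by rewrite mulr_ge0 ?invr_ge0// ltW.
  apply: (@le_trans _ _ (mx_integral (fun Z => a1%:E * T1 Z + a2%:E * T2 Z))).
    apply: le_mx_integral => //.
    - by apply: emeasurable_funD; apply: measurable_funeM.
    - move=> Z; rewrite -!EFinM -EFinD lee_fin.
      have x0 : (0 <= (gram (Y Z *m S))^-1)%R by rewrite invr_ge0 gram_ge0.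
      have y0 : (0 <= (gram (Y Z))^-1)%R by rewrite invr_ge0 gram_ge0.
      apply: le_trans (Young_weighted (p + k) sigma0 x0 y0) _.
      by rewrite sigmaV_rho mulrDr /a1 /a2 !mulrA.
  rewrite /mx_integral ge0_integralD//; last 4 first.
  - by move=> v _; rewrite mule_ge0// lee_fin.
  - exact: measurable_funeM.
  - by move=> v _; rewrite mule_ge0// lee_fin.
  - exact: measurable_funeM.
  rewrite !ge0_integralZl_EFin// -!/(mx_integral _).
  rewrite [X in _ * X + _](PSE : mx_integral T1 = _) [X in _ + _ * X]T2E.
  rewrite -!EFinM -EFinD lee_fin le_eqVlt; apply/orP; left; apply/eqP.
  have -> : (a1 * (tau ^+ m * c) = n%:R^-1 * (p + k)%:R * rho * c)%R.
    by rewrite -sigma_rho /a1; ring.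
  rewrite /a2 -!mulrDl; congr (_ * _ )%R.
  rewrite -[RHS]mul1r; congr (_ * _)%R.
  rewrite -{2}[(n%:R^-1)%R]mulr1 -mulrDr natr1 mulVf//.
rewrite -(lee_pmul2r (x := (tau ^+ p * vol n ^+ p)%:E)) ?lte_fin//; last first.
  by rewrite mulr_gt0// exprn_gt0.
rewrite H1; apply: le_trans H2 _; apply: le_trans (lee_wpmul2r _ H3) _.
  by rewrite lee_fin mulr_ge0 ?(ltW b_gt0).
rewrite -!EFinM lee_fin le_eqVlt; apply/orP; left; apply/eqP.
(* The exponents agree because [m - m / n - p = 1 - m / n = k / n]. *)
have -> : (tau `^ (k%:R / n%:R) = rho / tau ^+ p)%R.
  rewrite -powR_mulrn ?ltW// -powRN /rho -powRD; last first.
    by apply/implyP => _; rewrite gt_eqF.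
  congr powR; have : (n%:R != 0 :> R)%R by rewrite gt_eqF.
  by rewrite !natrD; move: p%:R k%:R => u v uv; field.
have tp0 : (tau ^+ p != 0)%R by rewrite expf_neq0 ?gt_eqF.
have vm0 : (vol m != 0)%R by rewrite gt_eqF.
have nN0 : (n%:R != 0 :> R)%R by rewrite gt_eqF.
have mN0 : (m%:R != 0 :> R)%R by rewrite pnatr_eq0.
have cE : (c * b = n%:R / m%:R / vol m * (vol n * vol n ^+ p))%R.
  rewrite -exprS -cgm gmb; move: vm0 mN0 nN0.
  by move: (vol m) m%:R n%:R => x y z x0 y0 z0; field; rewrite x0 y0 z0.
have -> : (rho * c * (b * M) = c * b * rho * M)%R by ring.
rewrite cE; move: tp0 mN0 vm0.
move: (tau ^+ p)%R (vol n ^+ p)%R m%:R n%:R (vol n) (vol m) => t v x y z z' t0 x0 z0.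
by field; rewrite t0 x0 z0.
Qed.

End slicing_inequality.

(** * The maximal section *)

Section limn_einf_bounds.
Context {R : realType}.
Local Open Scope ereal_scope.

Lemma limn_einf_le (u : (\bar R)^nat) w : (forall k, u k <= w) -> limn_einf u <= w.
Proof.
move=> uw; rewrite limn_einf_lim; apply: lime_le; first exact: is_cvg_einfs.
near=> k; apply: le_trans (uw k); apply: ereal_inf_lbound.
by exists k => //=.
Unshelve. all: by end_near. Qed.

Lemma limn_einf_ge (u : (\bar R)^nat) v :
  (\forall k \near \oo, v <= u k) -> v <= limn_einf u.
Proof.
move=> [N _ uv]; rewrite limn_einf_lim; apply: lime_ge; first exact: is_cvg_einfs.
near=> k; apply: le_ereal_inf_tmp => _ [l /= kl <-].
apply: uv => /=; apply: leq_trans kl.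
by near: k; exists N.
Unshelve. all: by end_near. Qed.

End limn_einf_bounds.

Section maximal_section.
Context {R : realType} (m n : nat) (h : 'rV[R]_n -> R) (c rho : R).
Local Open Scope ereal_scope.
Local Notation lam := (lebesgue_rV R).
Hypotheses (h0 : forall x, (0 <= h x)%R) (hc : forall x, (h x <= c)%R).
Hypothesis hrho : forall x, (rho < euclidean_norm x)%R -> h x = 0%R.
Hypothesis rho0 : (0 <= rho)%R.
Hypothesis mh : measurable_fun setT h.
Hypothesis usc_h : forall x (e : R), (0 < e)%R -> \forall z \near x, (h z < h x + e)%R.

Let V : set 'M[R]_(m, n) := [set U | U *m U^T = 1%:M].

Definition frame_integral (U : 'M[R]_(m, n)) : \bar R := \int[lam m]_y (h (y *m U))%:E.
Local Notation S := frame_integral.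

(** An integrable majorant common to all frames: [y |-> y *m U] preserves the norm, and [h] is
    bounded by [c] and vanishes beyond radius [rho]. *)
Let G (y : 'rV[R]_m) : R := (c * \1_(cube m rho) y)%R.

Let mhU (U : 'M[R]_(m, n)) : measurable_fun setT (fun y : 'rV[R]_m => h (y *m U)).
Proof.
by apply: (measurableT_comp mh); apply: mx_measurable_fun; mx_measurability.
Qed.

Let mG : measurable_fun setT G.
Proof.
by apply: measurable_funM => //; apply: measurable_indic; exact: measurable_cube.
Qed.

Let hG U y : V U -> (h (y *m U) <= G y)%R.
Proof.
move=> VU; rewrite /G indicE; have [yrho|] := leP (euclidean_norm y) rho.
  by rewrite mem_set ?mulr1// => i; exact: le_trans (ler_coord_euclidean_norm _ _) yrho.
move=> yrho; rewrite hrho ?euclidean_norm_mulmx//.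
by rewrite mulr_ge0// (le_trans (h0 0%R)).
Qed.

Let iG : \int[lam m]_y (G y)%:E = (c * (rho *+ 2) ^+ m)%:E.
Proof.
have c0 : (0 <= c)%R by exact: le_trans (hc 0%R).
under eq_integral do rewrite EFinM.
rewrite ge0_integralZl_EFin//; last first.
  by apply/measurable_EFinP/measurable_indic; exact: measurable_cube.
rewrite integral_indic ?setIT//; last exact: measurable_cube.
by rewrite EFinM; congr (_ * _); exact: lebesgue_rV_cube.
Qed.

Let integrable_G : (lam m).-integrable setT (EFin \o G).
Proof.
apply/integrableP; split; first exact/measurable_EFinP.
under eq_integral => y _.
  rewrite /= ger0_norm; last first.
    by rewrite mulr_ge0 ?indicE// (le_trans (h0 0%R)).
  over.
by rewrite iG ltry.
Qed.

Let integrable_h U : V U -> (lam m).-integrable setT (fun y => (h (y *m U))%:E).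
Proof.
move=> VU; apply: (le_integrable _ _ _ integrable_G) => //.
  exact/measurable_EFinP.
move=> y _ /=; rewrite lee_fin ger0_norm// ger0_norm ?hG//.
by apply: le_trans (hG y VU).
Qed.

Lemma frame_integral_fin_num U : V U -> S U \is a fin_num.
Proof. by move=> VU; apply: integrable_fin_num => //; exact: integrable_h. Qed.

(** Reverse Fatou: Fatou's lemma is applied to the non-negative functions [G y - h (y *m u k)], and
    upper semicontinuity bounds their lower limit below by [G y - h (y *m U)]. *)
Lemma frame_integral_limit (u : nat -> 'M[R]_(m, n)) U (a : R) :
  (forall k, V (u k)) -> V U -> u k @[k --> \oo] --> U ->
  (forall k, a%:E <= S (u k)) -> a%:E <= S U.
Proof.
move=> Vu VU uU au.
pose f (k : nat) y : \bar R := (G y - h (y *m u k))%:E.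
have f0 k y : 0 <= f k y by rewrite lee_fin subr_ge0 hG.
have mf k : measurable_fun setT (f k).
  by apply/measurable_EFinP; exact: measurable_funB.
have If W : V W -> \int[lam m]_y (G y - h (y *m W))%:E =
    (c * (rho *+ 2) ^+ m)%:E - S W.
  move=> VW; rewrite -iG -integralB_EFin//; exact: integrable_h.
have := fatou (lam m) measurableT mf (fun k y _ => f0 k y).
move/(le_trans _) => fat.
have : (c * (rho *+ 2) ^+ m)%:E - S U <= (c * (rho *+ 2) ^+ m)%:E - a%:E.
  rewrite -If//; apply: (le_trans (fat _ _)).
    apply: ge0_le_integral => //.
    - by move=> y _; rewrite lee_fin subr_ge0 hG.
    - by apply/measurable_EFinP; exact: measurable_funB.
    - rewrite /limn_einf; apply: (measurableT_comp (f := -%E)) => //.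
      apply: (measurable_fun_limn_esup (f := fun k y => - f k y)) => k.
      exact: (measurableT_comp (f := -%E)).
    move=> y _; apply/lee_addgt0Pr => e e0.
    rewrite -leeBlDr// -EFinB; apply: limn_einf_ge.
    have yuU : y *m u k @[k --> \oo] --> y *m U.
      by apply: cvg_mulmx => //; exact: cvg_cst.
    have near_k : \forall k \near \oo, (h (y *m u k) < h (y *m U) + e)%R.
      exact: yuU (usc_h (y *m U) e0).
    apply: filterS near_k => k hk.
    by rewrite /f lee_fin lerBlDr; move: hk; rewrite -(ltrD2l (G y)); lra.
  apply: limn_einf_le => k; rewrite If//.
  exact: leeB.
rewrite leeD2lE// leeN2//.
Qed.

Let compact_V : compact V.
Proof.
apply: (@mx_bounded_closed_compact _ _ _ _ 1%R).
  move=> U VU i j; have : ((U *m U^T) i i = 1)%R by rewrite VU mxE eqxx.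
  rewrite mxE (bigD1 j)//= mxE -expr2 => UU.
  have U1 : (U i j ^+ 2 <= 1)%R.
    rewrite -UU lerDl sumr_ge0// => k _.
    by rewrite mxE -expr2 sqr_ge0.
  by rewrite -(@ler_pXn2r _ 2)// ?nnegrE// expr1n real_normK ?num_real.
rewrite (_ : V = (fun U : 'M[R]_(m, n) => U *m U^T) @^-1` [set 1%:M])//.
apply: closed_comp => [U _|].
  apply: (@cvg_mulmx _ _ (nbhs U)); first exact: cvg_id.
  by apply: (@cvg_trmx _ _ (nbhs U)); exact: cvg_id.
by apply: accessible_closed_set1; apply: hausdorff_accessible; exact: norm_hausdorff.
Qed.

Lemma frame_integral_max : V !=set0 -> exists2 U, V U & forall W, V W -> S W <= S U.
Proof.
move=> [U0 VU0]; pose s := ereal_sup [set S U | U in V].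
have Ss U : V U -> S U <= s.
  by move=> VU; apply: ereal_sup_ubound; exists U.
have sfin : s \is a fin_num.
  rewrite fin_real//; apply/andP; split.
    apply: (@lt_le_trans _ _ 0) => //; apply: le_trans (Ss _ VU0).
    by apply: integral_ge0 => y _; rewrite lee_fin.
  apply: (@le_lt_trans _ _ (c * (rho *+ 2) ^+ m)%:E); last exact: ltry.
  apply: ge_ereal_sup => _ [U VU <-]; rewrite -iG.
  apply: ge0_le_integral => //; try exact/measurable_EFinP.
  - by move=> y _; rewrite lee_fin.
  - by move=> y _; rewrite lee_fin hG.
have /choice[u uP] : forall k : nat, exists U, V U /\ s - (k.+1%:R^-1)%:E < S U.
  move=> k; have [||_ [U VU <-] sU] := @ub_ereal_sup_adherent _ [set S U | U in V] (k.+1%:R^-1)%R.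
  - by rewrite invr_gt0 ltr0n.
  - exact: sfin.
  - by exists U.
have [|U [VU clU]] := compact_V (F := u @ \oo).
  by exists 0%N => // k _; exact: (uP k).1.
have /choice[phi phiP] : forall k : nat, exists j, (k <= j)%N /\
    ball U (k.+1%:R^-1)%R (u j).
  move=> k; have [||_ [[j /= kj <-] ballj]] :=
      clU [set u j | j in [set j | (k <= j)%N]] (ball U (k.+1%:R^-1)%R).
  - by exists k => // j kj; exists j.
  - by apply: nbhsx_ballx; rewrite invr_gt0 ltr0n.
  - by exists j.
exists U => // W VW; apply: le_trans (Ss _ VW) _.
apply/lee_addgt0Pr => e e0.
have [N _ Ne] := near_infty_natSinv_lt (PosNum e0).
rewrite -leeBlDr// -(fineK sfin) -EFinB.
(* [phi] selects terms approaching the cluster point [U], and [phi j >= j]. The shift by [N] makes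
   every selected term exceed the supremum minus [e], as the limit lemma asks for a bound valid
   along the whole sequence. *)
apply: (@frame_integral_limit (fun k => u (phi (k + N)%N))) => //.
- by move=> k; exact: (uP _).1.
- apply/cvg_ballP => d d0.
  have := near_infty_natSinv_lt (PosNum d0); apply: filterS => k kd.
  apply: le_ball (phiP (k + N)%N).2; apply: le_trans (ltW kd).
  by rewrite lef_pV2 ?posrE ?ltr0n// ler_nat ltnS leq_addr.
- move=> k; apply: le_trans (ltW (uP _).2); rewrite -[s in leRHS](fineK sfin) -EFinB.
  rewrite lee_fin lerD2l lerN2; apply: ltW; apply: Ne => /=.
  by apply: leq_trans (phiP _).1; exact: leq_addl.
Qed.

End maximal_section.

(** * Extension of the density by zero, and measures of sections *)

Section upper_semicontinuous.
Context {R : realType} (n : nat).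

Lemma upper_semicontinuous_measurable_rV (h : 'rV[R]_n -> R) :
  (forall x (e : R), 0 < e -> \forall z \near x, h z < h x + e) ->
  measurable_fun setT h.
Proof.
move=> usc; apply: (measurability _ (RGenInftyO.measurableE R)).
move=> _ [_ [a ->] <-]; rewrite setTI.
suff oh : @open 'rV[R]_n (h @^-1` `]-oo, a[) by exact: open_measurable_rV.
rewrite openE => x /=; rewrite in_itv/= => hxa.
have := usc x (a - h x); rewrite subr_gt0 => /(_ hxa).
by apply: filterS => z; rewrite addrC subrK /= in_itv.
Qed.

Variables (L : set 'rV[R]_n) (g : 'rV[R]_n -> R).
Hypotheses (closedL : closed L) (g_cont : {within L, continuous g}).
Hypothesis g_ge0 : forall x, L x -> 0 <= g x.

Definition extend0 (x : 'rV[R]_n) : R := \1_L x * g x.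

Lemma extend0E x : L x -> extend0 x = g x.
Proof. by move=> Lx; rewrite /extend0 indicE mem_set// mul1r. Qed.

Lemma extend0N x : ~ L x -> extend0 x = 0.
Proof. by move=> Lx; rewrite /extend0 indicE memNset// mul0r. Qed.

Lemma extend0_ge0 x : 0 <= extend0 x.
Proof.
have [Lx|Lx] := pselect (L x); first by rewrite extend0E ?g_ge0.
by rewrite extend0N.
Qed.

(** Leaving [L] can only lower the value, since the density is non-negative, and the complement of
    the closed set [L] is open. *)
Lemma upper_semicontinuous_extend0 x (e : R) : 0 < e ->
  \forall z \near x, extend0 z < extend0 x + e.
Proof.
move=> e0; have [Lx|Lx] := pselect (L x).
  move/subspace_continuousP : g_cont => /(_ x Lx) /cvgrPdist_lt /(_ e e0).
  rewrite near_withinE; apply: filterS => z gz.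
  have [Lz|Lz] := pselect (L z).
    rewrite !extend0E//; have := gz Lz; rewrite distrC.
    by move/(le_lt_trans (ler_norm _)); rewrite ltrBlDl.
  by rewrite extend0N// ltr_wpDl// extend0_ge0.
have : \forall z \near x, (~` L) z.
  by apply: open_nbhs_nbhs; split => //; exact: closed_openC.
by apply: filterS => z Lz; rewrite !extend0N// add0r.
Qed.

Lemma measurable_extend0 : measurable_fun setT extend0.
Proof.
by apply: upper_semicontinuous_measurable_rV; exact: upper_semicontinuous_extend0.
Qed.

End upper_semicontinuous.

Section section_measures.
Context {R : realType} (n : nat) (L : set 'rV[R]_n) (g : 'rV[R]_n -> R).
Hypotheses (closedL : closed L) (g_cont : {within L, continuous g}).
Hypothesis g_ge0 : forall x, L x -> 0 <= g x.
Local Open Scope ereal_scope.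
Local Notation lam := (lebesgue_rV R).
Local Notation h := (extend0 L g).

Lemma integral_extend0 (mu : {measure set 'rV[R]_n -> \bar R}) :
  \int[mu]_(x in L) (g x)%:E = \int[mu]_x (h x)%:E.
Proof.
rewrite integral_mkcond; apply: eq_integral => x _; rewrite patchE.
case: ifPn => [/set_mem Lx|]; first by rewrite extend0E.
by rewrite notin_setE => Lx; rewrite extend0N.
Qed.

Lemma orthobasisP (H : {vspace 'rV[R]_n}) : orthonormal_basis (orthobasis H).
Proof. by have [U HU] := orthonormal_basis_neq0 H; exact: (xgetI _ HU). Qed.

Lemma memv_orthobasis (H : {vspace 'rV[R]_n}) x :
  (x \in H) = (x <= orthobasis H)%MS.
Proof.
have [OO OH] := orthobasisP H.
have /row_space[H' dH' HO] : row_free (orthobasis H).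
  by apply/row_freeP; exists (orthobasis H)^T.
have HH' : H' = H; last by rewrite -HO HH'.
apply/eqP; rewrite eqEdim dH' leqnn andbT; apply/subvP => y.
rewrite HO => /submxP[z ->]; rewrite mulmx_sum_row.
by apply: memv_suml => i _; exact/memvZ/OH.
Qed.

(** The subspace is closed, being the fixed-point set of the orthogonal projection [P]. *)
Let measurable_vspace (H : {vspace 'rV[R]_n}) : measurable [set` H].
Proof.
have [OO _] := orthobasisP H.
pose P := (orthobasis H)^T *m orthobasis H.
have -> : [set` H] = (fun x : 'rV[R]_n => x *m P - x)%R @^-1` [set 0%R].
  apply/seteqP; split => x /=; rewrite memv_orthobasis.
    by move=> /submxP[y ->]; rewrite mulmxA -(mulmxA y) OO mulmx1 subrr.
  by move/eqP; rewrite subr_eq0 mulmxA => /eqP <-; exact: submxMl.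
rewrite -[X in measurable X]setCK; apply: measurableC; apply: open_measurable_rV.
apply: closed_openC; apply: closed_comp => [x _|].
  apply: (@cvgB _ _ _ (nbhs x)); last exact: cvg_id.
  by apply: (@cvg_mulmx _ _ (nbhs x)); [exact: cvg_id|exact: cvg_cst].
by apply: accessible_closed_set1; apply: hausdorff_accessible; exact: norm_hausdorff.
Qed.

Lemma section_measureE (H : {vspace 'rV[R]_n}) :
  section_measure g L H = frame_integral h (orthobasis H).
Proof.
have mh := measurable_extend0 closedL g_cont g_ge0.
have h0 := extend0_ge0 g_ge0.
have mO := @measurable_mulmx R n _ (orthobasis H).
have -> : section_measure g L H =
    \int[lebesgue_vspace H]_(x in [set` H]) (h x)%:E.
  rewrite /section_measure [LHS]integral_mkcond [RHS]integral_mkcond.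
  apply: eq_integral => x _; rewrite !patchE in_setI.
  case: (x \in [set` H]); rewrite ?andbF ?andbT//.
  case: ifPn => [/set_mem Lx|]; first by rewrite extend0E.
  by rewrite notin_setE => Lx; rewrite extend0N.
have mhE : measurable_fun [set` H] (fun x => (h x)%:E).
  by apply: (measurable_funS measurableT) => //; exact/measurable_EFinP.
have hE0 : {in [set` H], forall x, 0 <= (h x)%:E}.
  by move=> x _; rewrite lee_fin.
have := ge0_integral_pushforward mO (lam (\dim H)) (measurable_vspace H) mhE hE0.
have -> : (fun y => y *m orthobasis H) @^-1` [set` H] = setT.
  by apply/seteqP; split => y //= _; rewrite memv_orthobasis submxMl.
by move=> hE; refine (etrans _ hE); apply: eq_measure_integral.
Qed.

(** Two orthonormal frames of one subspace differ by an orthogonal matrix, whose determinant has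
    absolute value 1. The equality [d = m] is a hypothesis because [\dim H] equals [m] only
    propositionally. *)
Lemma frame_integral_same_span d m (O : 'M[R]_(d, n)) (U : 'M[R]_(m, n)) :
  d = m -> O *m O^T = 1%:M -> U *m U^T = 1%:M -> (O <= U)%MS ->
  frame_integral h O = frame_integral h U.
Proof.
move=> dm; subst d => OO UU /submxP[A OA].
have mh := measurable_extend0 closedL g_cont g_ge0.
have h0 := extend0_ge0 g_ge0.
have AA : A *m A^T = 1%:M.
  by rewrite -OO OA trmx_mul mulmxA -(mulmxA A) UU mulmx1.
rewrite /frame_integral OA; under eq_integral do rewrite mulmxA.
rewrite (ge0_integral_mulmx (f := fun y => (h (y *m U))%:E)) ?orthogonal_unitmx//.
- by rewrite orthogonal_det// invr1 mul1e.
- apply/measurable_EFinP; apply: (measurableT_comp mh).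
  by apply: mx_measurable_fun; mx_measurability.
- by move=> y; rewrite lee_fin.
Qed.

(** This moves the maximum from subspaces to orthonormal frames, where compactness is at hand. *)
Lemma section_measure_Grassmannian m :
  [set section_measure g L H | H in Grassmannian R n m] =
  [set frame_integral h U | U in [set U : 'M[R]_(m, n) | U *m U^T = 1%:M]].
Proof.
apply/seteqP; split => [_ [H dH <-]|_ [U UU <-]].
  have [OO _] := orthobasisP H; rewrite section_measureE.
  by move: (orthobasis H) OO; rewrite dH => O OO; exists O.
have fU : row_free U by apply/row_freeP; exists U^T.
have [H dH HU] := row_space fU; exists H => //.
have [OO OH] := orthobasisP H; rewrite section_measureE.
apply: frame_integral_same_span => //.
by apply/row_subP => i; rewrite -HU.
Qed.

End section_measures.

(** * Assembling the inequality *)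

Section enclosing_ellipsoid.
Context {R : realType} (N : nat) (L : set 'rV[R]_N.+1).
Hypotheses (N_gt0 : (0 < N)%N) (bodyL : convex_body L) (symL : origin_symmetric L).
Local Notation n := N.+1.
Local Notation lam := (lebesgue_rV R).
Local Notation vol := (@ball_volume R).

Lemma measurable_convex_body : measurable L.
Proof.
rewrite -[L]setCK; apply: measurableC; apply: open_measurable_rV.
exact: closed_openC (convex_body_closed bodyL).
Qed.

Lemma convex_body_fin_num : lam n L \is a fin_num.
Proof.
have [c Lc] := convex_body_bounded bodyL.
have [c' c0 Lc'] : exists2 c', 0 <= c' & L `<=` cube n c'.
  exists (Num.max 0 c); first by rewrite le_max lexx.
  by move=> x Lx i; rewrite le_max Lc ?orbT.
rewrite ge0_fin_numE//; apply: (@le_lt_trans _ _ (lam n (cube n c'))).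
  by apply: le_measure => //; rewrite inE; [exact: measurable_convex_body|exact: measurable_cube].
by rewrite lebesgue_rV_cube// ltry.
Qed.

Lemma enclosing_ellipsoid : exists T : 'M[R]_n, [/\ T \in unitmx,
  forall x, L x -> euclidean_norm (x *m invmx T) <= 1 &
  `|\det T| * vol n <= Num.sqrt n%:R ^+ n * fine (lam n L)].
Proof.
have [T [uT TL LT]] := John_ellipsoid N_gt0 bodyL symL.
set r : R := Num.sqrt n%:R in LT *.
have r0 : 0 < r by rewrite sqrtr_gt0 ltr0n.
have ur : r%:M \in @unitmx R n by rewrite unitmxE det_scalar unitfE expf_neq0// gt_eqF.
(* John's ellipsoid, contained in [L], is dilated by [sqrt n]: it then contains [L], and its volume
   is [r ^+ n] times that of a subset of [L]. *)
exists (r *: T); split.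
- by rewrite -mul_scalar_mx unitmx_mul ur.
- move=> x /LT xr; rewrite invmxZ; last by rewrite -mul_scalar_mx unitmx_mul ur.
  rewrite -scalemxAr euclidean_normZ gtr0_norm ?invr_gt0//.
  by rewrite ler_pdivrMl// mulr1.
rewrite detZ normrM normrX gtr0_norm// -mulrA ler_wpM2l ?exprn_ge0 ?(ltW r0)//.
rewrite -lee_fin fineK ?convex_body_fin_num//.
rewrite -[lam n L]/(lam n L) -[X in (_ <= _ X)%E]setIT.
have mL := measurable_convex_body.
rewrite -(integral_indic _ measurableT)//.
have mB := @measurable_euclidean_ball R n.
have uiT : invmx T \in unitmx by rewrite unitmx_inv.
have := ge0_integral_mulmx (f := fun x => (\1_(euclidean_ball R n) x)%:E) _ _ uiT.
rewrite integral_indic_ball det_inv normfV invrK EFinM => <-//; last first.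
  by apply/measurable_EFinP; exact: measurable_indic.
apply: ge0_le_integral => //.
- apply/measurable_EFinP; apply: measurable_indic_ball.
  by mx_measurability.
- by apply/measurable_EFinP; exact: measurable_indic.
move=> x _; rewrite lee_fin indic_ball; case: ifPn => // x1.
by rewrite indicE mem_set// -(mulmxKV uT x); exact: TL.
Qed.

End enclosing_ellipsoid.

(** The volume comparison is raised to the power [t = k / n], which turns [(sqrt n)^n] into
    [n^(k/2)]. Splitting [V] as [V^(m/n) V^(k/n)] supplies the factor [V^t] needed beside [d^t] and
    leaves the numerator of [slicing_constant]. *)
Lemma slicing_constant_bound (R : realType) (m k : nat) (V Vm d l : R) :
  (0 < m)%N -> (0 < k)%N -> 0 < V -> 0 < Vm -> 0 <= d -> 0 <= l ->
  d * V <= Num.sqrt (m + k)%:R ^+ (m + k) * l ->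
  (m + k)%:R / m%:R * (V / Vm) * d `^ (k%:R / (m + k)%:R) <=
  (m + k)%:R `^ (k%:R / 2) * ((m + k)%:R / m%:R) *
    (V `^ (m%:R / (m + k)%:R) / Vm) * l `^ (k%:R / (m + k)%:R).
Proof.
move=> m0 k0 V0 Vm0 d0 l0 dl; set n := (m + k)%N in dl *.
have n0 : 0 < n%:R :> R by rewrite ltr0n addn_gt0 m0.
pose t : R := k%:R / n%:R.
have t0 : 0 <= t by rewrite divr_ge0.
have dV : d `^ t * V `^ t <= n%:R `^ (k%:R / 2) * l `^ t.
  rewrite -powRM ?(ltW V0)//; apply: le_trans (ge0_ler_powR _ _ _ dl) _ => //.
  - by rewrite nnegrE mulr_ge0 ?(ltW V0).
  - by rewrite nnegrE mulr_ge0// exprn_ge0// sqrtr_ge0.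
  rewrite powRM ?exprn_ge0 ?sqrtr_ge0// -powR12_sqrt ?(ltW n0)//.
  rewrite -powR_mulrn ?powR_ge0// -!powRrM.
  rewrite (_ : 2^-1 * (n%:R * t) = k%:R / 2)// /t.
  by field; rewrite gt_eqF.
have VE : V = V `^ (m%:R / n%:R) * V `^ t.
  rewrite -powRD; last by apply/implyP => _; rewrite gt_eqF.
  by rewrite -mulrDl -natrD -/n mulfV ?gt_eqF// powRr1// ltW.
rewrite {1}VE.
have -> : n%:R / m%:R * (V `^ (m%:R / n%:R) * V `^ t / Vm) * d `^ t =
    (n%:R / m%:R * (V `^ (m%:R / n%:R) / Vm)) * (d `^ t * V `^ t) by ring.
apply: le_trans (ler_wpM2l _ dV) _.
  by rewrite mulr_ge0 ?divr_ge0 ?powR_ge0// ltW.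
by rewrite le_eqVlt; apply/orP; left; apply/eqP; rewrite -/t; ring.
Qed.

Theorem theorem2 (R : realType) (n k : nat) (L : set 'rV[R]_n)
    (mu : {measure set 'rV[R]_n -> \bar R}) (g : 'rV[R]_n -> R)
    (n_ge2 : (2 <= n)%N) (k_ge1 : (1 <= k)%N) (k_le : (k <= n - 1)%N)
    (bodyL : convex_body L) (symL : origin_symmetric L)
    (g_cont : {within L, continuous g})
    (g_even : forall x, L x -> g (- x) = g x)
    (g_ge0 : forall x, L x -> 0 <= g x)
    (mu_density : has_density_on mu L g) :
  exists2 M : \bar R,
    is_maximum [set section_measure g L H | H in Grassmannian R n (n - k)] M &
    (mu L <= (n%:R `^ (k%:R / 2) * (n%:R / (n - k)%:R) *
              slicing_constant R n k)%:E *
             M * lebesgue_rV R n L `^ (k%:R / n%:R))%E.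
Proof.
have [p nE] : exists p, n = (p.+1 + k)%N by exists (n - k).-1; lia.
move: L mu g bodyL symL g_cont g_even g_ge0 mu_density n_ge2 k_le.
subst n => L mu g bodyL symL g_cont _ g_ge0 mu_density _ _.
have closedL := convex_body_closed bodyL.
have mh := measurable_extend0 closedL g_cont g_ge0.
have h0 := extend0_ge0 g_ge0.
have usc := upper_semicontinuous_extend0 closedL g_cont g_ge0.
have N0 : (0 < p + k)%N by lia.
have [T [uT LT VT]] := @enclosing_ellipsoid R (p + k) L N0 bodyL symL.
have [C hC] : exists C, forall x, extend0 L g x <= C.
  have [cL _ _] := bodyL.
  have [C [_ gC]] := compact_bounded (continuous_compact g_cont cL).
  exists (`|C| + 1) => x; have [Lx|Lx] := pselect (L x).
    rewrite extend0E//; apply: le_trans (ler_norm _) (gC _ _ (g x) _).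
      by apply: le_lt_trans (ler_norm _) _; rewrite ltrDl.
    by exists x.
  by rewrite extend0N// addr_ge0.
have [c Lc] := convex_body_bounded bodyL.
(* The Euclidean norm of the corner of the cube of half-side [c], which contains [L]. *)
pose rho : R := Num.sqrt (\sum_(i < p.+1 + k) c ^+ 2).
have hrho x : rho < euclidean_norm x -> extend0 L g x = 0.
  move=> xrho; rewrite extend0N// => Lx; move: xrho; rewrite ltNge => /negP; apply.
  rewrite ler_sqrt ?sumr_ge0// => [|i _]; last exact: sqr_ge0.
  apply: ler_sum => i _; rewrite -real_normK ?num_real// lerXn2r ?nnegrE//.
    exact: le_trans (Lc _ Lx i).
  exact: Lc.
have [|U UU Umax] := @frame_integral_max R p.+1 (p.+1 + k) _ C rho h0 hC hrho
    (sqrtr_ge0 _) mh usc.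
  by exists (row_mx 1%:M 0); rewrite /= tr_row_mx mul_row_col trmx0 mulmx0 addr0 trmx1 mulmx1.
exists (frame_integral (extend0 L g) U).
  rewrite addnK section_measure_Grassmannian//; split; first by exists U.
  by move=> _ [W WW <-]; exact: Umax.
have SU := frame_integral_fin_num h0 hC hrho (sqrtr_ge0 _) mh UU.
rewrite mu_density//; last exact: measurable_convex_body.
rewrite integral_extend0// -(fineK SU) -(fineK (convex_body_fin_num bodyL)).
set M := fine (frame_integral _ _); set l := fine _.
have M0 : 0 <= M by apply: fine_ge0; apply: integral_ge0 => y _; rewrite lee_fin.
have l0 : 0 <= l by exact: fine_ge0.
have uiT : invmx T \in unitmx by rewrite unitmx_inv.
have mE : measurable_fun setT (fun x => (extend0 L g x)%:E) by exact/measurable_EFinP.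
have hE0 x : (0 <= (extend0 L g x)%:E)%E by rewrite lee_fin.
have sM (W : 'M[R]_(1 + p, 1 + p + k)) : W *m W^T = 1%:M ->
    (\int[lebesgue_rV R (1 + p)]_y (extend0 L g (y *m W))%:E <= M%:E)%E.
  by move=> WW; rewrite fineK//; exact: Umax.
have sT x : ~ (euclidean_norm (x *m invmx T) <= 1) -> (extend0 L g x)%:E = 0%E.
  by move=> xT; congr EFin; rewrite extend0N// => Lx; exact/xT/LT.
(* Here [S] is [invmx T], so the inverse of [|\det S|] is [|\det T|], the volume of the ellipsoid
   relative to the unit ball. *)
have := @slicing_inequality R p k k_ge1 _ M mE hE0 sM (invmx T) uiT sT.
rewrite det_inv normfV invrK => /le_trans; apply.
rewrite poweR_EFin -!EFinM lee_fin addnK /slicing_constant.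
have := @slicing_constant_bound R p.+1 k (ball_volume (p.+1 + k)) (ball_volume p.+1)
  `|\det T| l (ltn0Sn p) k_ge1 (ball_volume_gt0 _) (ball_volume_gt0 _) (normr_ge0 _) l0 VT.
move/(ler_wpM2r M0)/le_trans; apply.
by rewrite addnK mulrAC.
Qed.
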